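(* Let $q\in\{p,K,\gamma\}$ be one of the three positive parameters, varied over an open interval $Q\subset(0,\infty)$ while the other two are held fixed. Assume: (1) $c:\mathcal I\to\mathbb R_+$ is continuous and increasing and extends continuously to the endpoints with $0\le c(a)<c(b)<\infty$; (2) for each $q\in Q$ there exist $\widehat x\le\widetilde x$ in $\mathcal I$ (possibly depending on $q$) such that $r(x)=\gamma c(x)+p\mu(x)$ is strictly increasing on $(a,\widehat x)$, constant on $(\widehat x,\widetilde x)$, and strictly decreasing on $(\widetilde x,b)$; (3) there exists $\widehat x_\mu\in\mathcal I$ such that $\mu$ is strictly increasing on $(a,\widehat x_\mu)$ and concave on $(\widehat x_\mu,b)$; (4) for each $q\in Q$ there exists $(\widetilde w,\widetilde y)\in\mathcal R$ with $F(q;\widetilde w,\widetilde y)>\gamma\,\bar c(b)$. Let $(w_q^*,y_q^* )\in\mathcal R$ be the (unique) maximizer of $F(q;\cdot,\cdot)$, and assume $w_q^*>a$ for $q\in Q$. Put $F^*(q)=F(q;w_q^*,y_q^* )$, let $\dot F^*(q)=\frac{d}{dq}F^*(q)$, and let $\mathfrak z_q^*=\frac{y_q^*-w_q^*}{\xi(y_q^* )-\xi(w_q^* )}$. Then on $Q$, as functions of the parameter: - for $q=p$: $F^*(p)$ is increasing, $\dot F^*(p)$ is increasing, $y_p^*$ is decreasing, and $\mathfrak z_p^*$ is increasing; - for $q=K$: $F^*(K)$ is decreasing, $\dot F^*(K)$ is increasing, $w_K^*$ is decreasing, and $y_K^*$ is increasing; - for $q=\gamma$: $F^*(\gamma)$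 is increasing, $\dot F^*(\gamma)$ is increasing, $w_\gamma^*$ is increasing, and $y_\gamma^*$ is increasing. (The responses of $w_p^*$ to $p$, of $\mathfrak z_K^*$ to $K$, and of $\mathfrak z_\gamma^*$ to $\gamma$ are indeterminate: no direction is asserted for them.)
   Context: Setting. $\mathcal I=(a,b)$ with $-\infty<a<b\le\infty$, and $x_0\in\mathcal I$ is fixed. $\mu,\sigma:\mathcal I\to\mathbb R$ are measurable, $\sigma^2>0$ on $\mathcal I$, and $dX_0(t)=\mu(X_0(t))\,dt+\sigma(X_0(t))\,dW(t)$, $X_0(0)=x_0$, $W$ a Brownian motion, has a unique non-explosive weak solution, a regular diffusion on $\mathcal I$. Scale and speed densities: $s(x)=\exp\{-\int_{x_0}^x \frac{2\mu(u)}{\sigma^2(u)}du\}$, $m(x)=\frac{2}{\sigma^2(x)s(x)}$; $dS=s\,dx$, $dM=m\,dx$, $S[u,v]=\int_u^v s\,dx$, $M[u,v]=\int_u^v m\,dx$. Standing assumptions on the diffusion: the scale function and speed measure are absolutely continuous with these densities; $a$ is non-attracting, i.e. $S(a,y]=\infty$ for $y\in\mathcal I$; $b$ is natural, i.e. $\int_y^b M[y,v]\,dS(v)=\infty$ and $\int_y^b S[y,v]\,dM(v)=\infty$; $M[a,y]<\infty$ for each $y\in\mathcal I$; with $\xi(x)=\int_{x_0}^x M[a,v]\,dS(v)$ one has $\lim_{x\to b}\xi'(x)=\lim_{x\to b}s(x)M[a,x]=\infty$; $\mu$ is continuous on $\mathcal I$ and extends continuously to the boundary points with $|\mu(a)|<\infty$.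 The boundary $a$ is either an entrance point ($\int_a^y M[a,v]\,dS(v)<\infty$) or a natural point (this integral is infinite); put $\mathcal E=[a,b)$ if $a$ is entrance and $\mathcal E=(a,b)$ if $a$ is natural, and $\mathcal R=\{(w,y)\in\mathcal E\times\mathcal E: w<y\}$. Further notation: $g(x)=\int_{x_0}^x\int_a^v c(u)\,dM(u)\,dS(v)$ (values at $a$, when $a$ is entrance, are limits); $\xi,g$ are twice continuously differentiable on $\mathcal I$. For $(w,y)\in\mathcal R$, $$F(q;w,y)=\frac{p(y-w)-K+\gamma(g(y)-g(w))}{\xi(y)-\xi(w)},$$ viewed as depending on the chosen parameter $q\in\{p,K,\gamma\}$. $\bar c(b)=c(b)$ if $M[a,b]=\infty$ and $\bar c(b)=\int c\,d\pi$ with $\pi(du)=dM(u)/M[a,b]$ if $M[a,b]<\infty$. *)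

(* Defs.v *)
From HB Require Import structures.
From mathcomp Require Import all_boot all_order all_algebra.
From mathcomp Require Import all_classical all_reals all_analysis.

Set Implicit Arguments.
Unset Strict Implicit.
Unset Printing Implicit Defensive.

Import Order.TTheory GRing.Theory Num.Theory.
Import numFieldNormedType.Exports.
Local Open Scope classical_set_scope.
Local Open Scope ring_scope.

Section stochastic_calculus.
Context {R : realType} {d : measure_display} {T : measurableType d}.
Variable P : probability T R.

(* Continuous-time objects are indexed by all of R; only times t >= 0 matter. *)

Definition is_filtration (Ft : R -> set (set T)) : Prop :=
  [/\ forall t : R, 0 <= t -> sigma_algebra setT (Ft t),
      forall t : R, 0 <= t -> Ft t `<=` measurable
    & forall s t : R, 0 <= s -> s <= t -> Ft s `<=` Ft t].

Definition adapted (Ft : R -> set (set T)) (X : R -> T -> R) : Prop :=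
  forall t : R, 0 <= t -> forall B : set R, measurable B -> Ft t (X t @^-1` B).

Definition continuous_paths (X : R -> T -> R) : Prop :=
  forall w, {within `[0, +oo[, continuous (fun t => X t w)}.

(* The last clause says at once that W t - W s is independent of Ft s and that
   it is normally distributed with variance t - s. *)
Definition is_brownian_motion (Ft : R -> set (set T)) (W : R -> T -> R) : Prop :=
  [/\ adapted Ft W, continuous_paths W, forall w, W 0 w = 0
    & forall s t : R, 0 <= s -> s < t ->
      forall (A : set T) (B : set R), Ft s A -> measurable B ->
        P (A `&` [set w | B (W t w - W s w)]) =
        (P A * normal_prob 0 (Num.sqrt (t - s)) B)%E].

(* sum_(i < n) h_i 1_]t_i, t_(i+1)] *)
Record simple_process := SimpleProcess {
  sp_size : nat;
  sp_time : nat -> R;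
  sp_coef : nat -> T -> R }.

Definition is_simple (Ft : R -> set (set T)) (H : simple_process) : Prop :=
  [/\ forall i, 0 <= sp_time H i,
      {homo sp_time H : i j / (i <= j)%N >-> i <= j},
      exists C, forall i w, `|sp_coef H i w| <= C
    & forall i (B : set R), measurable B ->
        Ft (sp_time H i) (sp_coef H i @^-1` B)].

Definition sp_eval (H : simple_process) (s : R) (w : T) : R :=
  \sum_(i < sp_size H)
    sp_coef H i w * \1_(`]sp_time H i, sp_time H i.+1]) s.

Definition sp_integral (W : R -> T -> R) (H : simple_process) (t : R) (w : T) : R :=
  \sum_(i < sp_size H) sp_coef H i w *
    (W (Num.min (sp_time H i.+1) t) w - W (Num.min (sp_time H i) t) w).

(* Z = int_0^t H dW : limit in probability of integrals of simple processes
   H_n with int_0^t |H_n - H|^2 ds -> 0 in probability. *)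
Definition is_ito_integral (Ft : R -> set (set T)) (W : R -> T -> R)
    (H : R -> T -> R) (t : R) (Z : T -> R) : Prop :=
  exists Hn : nat -> simple_process,
    [/\ forall n, is_simple Ft (Hn n),
        forall e : R, 0 < e ->
          P [set w | (e%:E <= \int[lebesgue_measure]_(s in `[0%R, t])
                              ((sp_eval (Hn n) s w - H s w) ^+ 2)%:E)%E]
            @[n --> \oo] --> 0%E
      & forall e : R, 0 < e ->
          P [set w | e <= `|sp_integral W (Hn n) t w - Z w|]
            @[n --> \oo] --> 0%E].

(* X is a non-explosive (I-valued for all times) solution, driven by W, of
   dX = mu(X) dt + sigma(X) dW, X(0) = x. *)
Definition is_solution (I : set R) (mu sigma : R -> R) (x : R)
    (Ft : R -> set (set T)) (W X : R -> T -> R) : Prop :=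
  [/\ is_filtration Ft, is_brownian_motion Ft W &
  [/\ adapted Ft X, continuous_paths X, forall w, X 0 w = x,
      forall (t : R) (w : T), 0 <= t -> I (X t w)
    & forall t : R, 0 <= t ->
        {ae P, forall w, (\int[lebesgue_measure]_(s in `[0%R, t])
                 (`|mu (X s w)| + sigma (X s w) ^+ 2)%:E < +oo)%E} /\
        is_ito_integral Ft W (fun s w => sigma (X s w)) t
          (fun w => X t w - x -
             \int[lebesgue_measure]_(s in `[0, t]) mu (X s w))]].

End stochastic_calculus.

Definition weak_existence {R : realType} (I : set R) (mu sigma : R -> R) (x : R) : Prop :=
  exists (d : measure_display) (T : measurableType d) (P : probability T R)
         (Ft : R -> set (set T)) (W X : R -> T -> R),
    is_solution P I mu sigma x Ft W X.

(* Equality of the finite-dimensional distributions of any two solutions. *)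
Definition uniqueness_in_law {R : realType} (I : set R) (mu sigma : R -> R) (x : R) : Prop :=
  forall (d1 : measure_display) (T1 : measurableType d1) (P1 : probability T1 R)
         (Ft1 : R -> set (set T1)) (W1 X1 : R -> T1 -> R)
         (d2 : measure_display) (T2 : measurableType d2) (P2 : probability T2 R)
         (Ft2 : R -> set (set T2)) (W2 X2 : R -> T2 -> R),
    is_solution P1 I mu sigma x Ft1 W1 X1 ->
    is_solution P2 I mu sigma x Ft2 W2 X2 ->
    forall (n : nat) (t : 'I_n -> R) (B : 'I_n -> set R),
      (forall i, 0 <= t i) -> (forall i, measurable (B i)) ->
      P1 [set w | forall i, B i (X1 (t i) w)] =
      P2 [set w | forall i, B i (X2 (t i) w)].

(* The SDE is well posed in I from every starting point, and the resulting
   diffusion is regular: every point of I is hit with positive probability. *)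
Definition is_regular_diffusion {R : realType} (I : set R) (mu sigma : R -> R) : Prop :=
  forall x, I x ->
    [/\ weak_existence I mu sigma x, uniqueness_in_law I mu sigma x
      & forall (d : measure_display) (T : measurableType d) (P : probability T R)
               (Ft : R -> set (set T)) (W X : R -> T -> R) (y : R),
          is_solution P I mu sigma x Ft W X -> I y ->
          (0 < P [set w | exists2 t : R, (0 <= t)%R & X t w = y])%E].

Section one_variable.
Context {R : realType}.
Implicit Types (f : R -> R) (D : set R).

Definition ooint (l r : \bar R) : set R := [set x | (l < x%:E < r)%E].

(* int_u^v f dx, with the sign convention int_u^v = - int_v^u. *)
Definition oriented_integral f (u v : R) : R :=
  if u <= v then \int[lebesgue_measure]_(x in ooint u%:E v%:E) f x
  else - \int[lebesgue_measure]_(x in ooint v%:E u%:E) f x.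

(* The filter x -> b, x < b. *)
Definition to_right_end (b : \bar R) : set_system R :=
  match b with
  | EFin r => r^'-
  | +oo%E => +oo%R
  | -oo%E => -oo%R
  end.

(* The extension of f to the point a by its right limit. *)
Definition extend_at (a : R) f : R -> R :=
  fun x => if x == a then lim (f t @[t --> a^'+]) else f x.

Definition C2_on D f : Prop :=
  forall x, D x -> [/\ derivable f x 1, derivable (derive1 f) x 1
                     & {for x, continuous (derive1n 2 f)}].

Definition concave_on D f : Prop :=
  convex_function (D : set (convex_lmodType R^o)) (fun x => - f x).

Definition increasing_on D f : Prop := {in D &, {homo f : x y / x <= y}}.
Definition decreasing_on D f : Prop := {in D &, {homo f : x y /~ x <= y}}.
Definition strictly_increasing_on D f : Prop := {in D &, {homo f : x y / x < y}}.
Definition strictly_decreasing_on D f : Prop := {in D &, {homo f : x y /~ x < y}}.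
Definition constant_on D f : Prop := {in D &, forall x y, f x = f y}.

End one_variable.

(* The endpoint b is an extended real because b = +oo is allowed. *)
Section diffusion.
Context {R : realType}.
Variables (a : R) (b : \bar R) (x0 : R) (mu sigma : R -> R).

Definition state_space : set R := ooint a%:E b.

Definition scale_density (x : R) : R :=
  expR (- oriented_integral (fun u => 2 * mu u / sigma u ^+ 2) x0 x).

Definition speed_density (x : R) : R := 2 / (sigma x ^+ 2 * scale_density x).

(* S[l, r] and M[l, r]; including or excluding endpoints is immaterial. *)
Definition scale_measure (l r : \bar R) : \bar R :=
  (\int[lebesgue_measure]_(x in ooint l r) (scale_density x)%:E)%E.

Definition speed_measure (l r : \bar R) : \bar R :=
  (\int[lebesgue_measure]_(x in ooint l r) (speed_density x)%:E)%E.

Definition left_speed_scale (y : R) : \bar R :=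
  (\int[lebesgue_measure]_(v in ooint a%:E y%:E)
     (speed_measure a%:E v%:E * (scale_density v)%:E))%E.

Definition is_entrance : Prop :=
  forall y, state_space y -> (left_speed_scale y < +oo)%E.

Definition is_left_natural : Prop :=
  forall y, state_space y -> left_speed_scale y = +oo%E.

Definition is_right_natural : Prop :=
  forall y, state_space y ->
    (\int[lebesgue_measure]_(v in ooint y%:E b)
       (speed_measure y%:E v%:E * (scale_density v)%:E) = +oo)%E /\
    (\int[lebesgue_measure]_(v in ooint y%:E b)
       (scale_measure y%:E v%:E * (speed_density v)%:E) = +oo)%E.

Definition left_speed (x : R) : R := fine (speed_measure a%:E x%:E).

Definition xi (x : R) : R :=
  oriented_integral (fun v => left_speed v * scale_density v) x0 x.

Definition gfun (c : R -> R) (x : R) : R :=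
  oriented_integral
    (fun v => (\int[lebesgue_measure]_(u in ooint a%:E v%:E)
                 (c u * speed_density u)) * scale_density v) x0 x.

Definition extended_space : set R :=
  [set x | state_space x \/ (is_entrance /\ x = a)].

Definition ordered_pairs : set (R * R) :=
  [set wy | [/\ extended_space wy.1, extended_space wy.2 & wy.1 < wy.2]].

(* cb is c(b) *)
Definition cbar (c : R -> R) (cb : R) : R :=
  if speed_measure a%:E b == +oo%E then cb
  else (\int[lebesgue_measure]_(u in state_space) (c u * speed_density u))
       / fine (speed_measure a%:E b).

(* The local integrability clauses make the scale and speed densities well
   defined. *)
Record standing_assumptions : Prop := {
  sa_interval : (a%:E < b)%E;
  sa_x0 : state_space x0;
  sa_mu_measurable : measurable_fun state_space mu;
  sa_sigma_measurable : measurable_fun state_space sigma;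
  sa_sigma_pos : forall x, state_space x -> 0 < sigma x ^+ 2;
  sa_drift_integrable : forall u v, state_space u -> state_space v ->
    lebesgue_measure.-integrable `[u, v]
      (fun x => (2 * mu x / sigma x ^+ 2)%:E);
  sa_speed_integrable : forall u v, state_space u -> state_space v ->
    lebesgue_measure.-integrable `[u, v] (fun x => (speed_density x)%:E);
  sa_diffusion : is_regular_diffusion state_space mu sigma;
  sa_left_non_attracting :
    forall y, state_space y -> scale_measure a%:E y%:E = +oo%E;
  sa_right_natural : is_right_natural;
  sa_left_speed_finite :
    forall y, state_space y -> (speed_measure a%:E y%:E < +oo)%E;
  sa_left_boundary : is_entrance \/ is_left_natural;
  sa_xi_C2 : C2_on state_space xi;
  sa_xi'_right : derive1 xi x @[x --> to_right_end b] --> +oo;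
  sa_sM_right :
    scale_density x * left_speed x @[x --> to_right_end b] --> +oo;
  sa_mu_continuous : {in state_space, continuous mu};
  sa_mu_left : exists l : R, mu x @[x --> a^'+] --> l;
  sa_mu_right : exists l : \bar R, (mu x)%:E @[x --> to_right_end b] --> l }.

End diffusion.

(* p, K and gamma *)
Record params (R : realType) := MkParams { price : R; fixed_cost : R; weight : R }.

Section objective.
Context {R : realType}.

Variant parameter_name := Par_p | Par_K | Par_gamma.

Definition with_parameter (k : parameter_name) (th : params R) (q : R) : params R :=
  match k with
  | Par_p => MkParams q (fixed_cost th) (weight th)
  | Par_K => MkParams (price th) q (weight th)
  | Par_gamma => MkParams (price th) (fixed_cost th) q
  end.

Definition revenue_rate (mu c : R -> R) (th : params R) (x : R) : R :=
  weight th * c x + price th * mu x.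

Variables (a : R) (b : \bar R) (x0 : R) (mu sigma c : R -> R).

Let xiE : R -> R := extend_at a (xi a x0 mu sigma).
Let gE : R -> R := extend_at a (gfun a x0 mu sigma c).

Definition Fobj (th : params R) (w y : R) : R :=
  (price th * (y - w) - fixed_cost th + weight th * (gE y - gE w))
  / (xiE y - xiE w).

Definition zratio (w y : R) : R := (y - w) / (xiE y - xiE w).

Definition is_unique_maximizer (th : params R) (w y : R) : Prop :=
  ordered_pairs a b x0 mu sigma (w, y) /\
  forall w' y', ordered_pairs a b x0 mu sigma (w', y') ->
    Fobj th w' y' <= Fobj th w y /\
    (Fobj th w' y' = Fobj th w y -> w' = w /\ y' = y).

End objective.

(* Main.v *)
Require Import Defs.
From HB Require Import structures.
From mathcomp Require Import all_boot all_order all_algebra.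
From mathcomp Require Import all_classical all_reals all_analysis.
From mathcomp Require Import measurable_realfun ring lra.

(** Write [A] and [C] for the averages of [mu] and [c] over [(a, x)] against the
    speed measure.  Since [a] is non-attracting, [1 / s(x) = int_a^x mu dM], so
    [xi' = s M], [1 = A xi'] and [g' = C xi'], and the first-order conditions at
    an interior maximizer read [h(w) = h(y) = F^*] with [h = p A + gamma C], the
    average of the unimodal function [r].  Averages of unimodal functions are
    strictly quasi-concave, hence [h > F^*] exactly on [(w, y)].

    [F] is affine in each parameter, so [F^*] has the subgradient
    [dF/dq (w_q, y_q)], which is therefore nondecreasing.  The signs of
    [h - F^*] at points close to [w] and [y] give continuity of [w_q] and [y_q],
    whence differentiability of [F^*].  The monotonicity of the maximizers
    follows by comparing [h_q(x)] with [F^*(q)] at the maximizer of another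
    parameter value; the remaining possibility, that the two intervals
    [(w, y)] lie side by side, would make the subgradient inequality an
    equality and is excluded by uniqueness of the maximizer. *)

Set Implicit Arguments.
Unset Strict Implicit.
Unset Printing Implicit Defensive.

Import Order.TTheory GRing.Theory Num.Theory.
Import numFieldNormedType.Exports.
Local Open Scope classical_set_scope.
Local Open Scope ring_scope.

(** * Integrals over open intervals *)

Section open_interval_integral.
Context {R : realType}.
Notation leb := (@lebesgue_measure R).
Implicit Types (f : R -> R) (l r u v x y : R).

(** Two obstacles shape the proof. The drift ratio [2 mu / sigma^2] is only locally integrable, so
    [1 / s] need not be differentiable everywhere and [1 / s(x) = int_a^x mu dM] cannot be read off
    from a pointwise derivative; it needs a chain rule for the exponential of an absolutely
    continuous function. Secondly, an implicit function argument for [w_q] and [y_q] would require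
    nonzero derivatives of [h] there, which strict quasi-concavity does not give; hence only signs
    of [h - F^*] are used.

    The parameters differ through [D = dh/dq], which is [A] for [p], [0] for [K] and [C] for
    [gamma]. If [D = 0], the curve [h] is fixed, the level [F^*] falls and the intervals are nested.
    If [D = C] is monotone, [dF/dq] lies between the values of [D] at the two ends and both ends
    move right. [D = A] is only quasi-concave, and one uses that the other summand [gamma C] of [h]
    is nondecreasing; this orders [A] at the two ends and settles the direction of [y_p] alone.

    Since [w_q > a], all derivatives are taken inside the state space, also when [a] is an entrance
    point. *)

Definition intoo f l r : R := \int[lebesgue_measure]_(x in `]l, r[) f x.

Lemma ooint_itv l r : ooint l%:E r%:E = `]l, r[%classic.
Proof. by apply/seteqP; split => x; rewrite /ooint /= in_itv /= !lte_fin. Qed.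

Lemma integrable_sub_oo f l r u v : leb.-integrable `]l, r[ (EFin \o f) ->
  l <= u -> v <= r -> leb.-integrable `]u, v[ (EFin \o f).
Proof.
move=> fi lu vr; apply: integrableS fi => //.
by apply: subset_itv; rewrite bnd_simp.
Qed.

Lemma intoo_id f l : intoo f l l = 0.
Proof. by rewrite /intoo set_itv_ge ?Rintegral_set0// bnd_simp ltxx. Qed.

Lemma intoo_split f l m r : l <= m -> m <= r ->
  leb.-integrable `]l, r[ (EFin \o f) ->
  intoo f l r = intoo f l m + intoo f m r.
Proof.
rewrite (le_eqVlt l) => /predU1P[<-|lm]; first by rewrite intoo_id add0r.
rewrite (le_eqVlt m) => /predU1P[->|mr fi]; first by rewrite intoo_id addr0.
have := @Rintegral_itvB R f (BRight l) (BLeft r) m fi.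
rewrite !bnd_simp => /(_ (ltW lm) mr) H.
rewrite /intoo -H -Rintegral_itv_bndo_bndc ?subrKC//.
by apply: integrable_sub_oo fi _ _ => //; exact: ltW.
Qed.

Lemma oriented_integralE f l r u v : leb.-integrable `]l, r[ (EFin \o f) ->
  l <= u <= r -> l <= v <= r ->
  oriented_integral f u v = intoo f l v - intoo f l u.
Proof.
move=> fi /andP[lu ur] /andP[lv vr]; rewrite /oriented_integral.
have fS z : z <= r -> leb.-integrable `]l, z[ (EFin \o f).
  by move=> zr; exact: integrable_sub_oo fi _ zr.
case: ifPn => [uv|]; first by rewrite ooint_itv (@intoo_split f l u v) ?fS// addrC addKr.
rewrite -ltNge => /ltW vu.
by rewrite ooint_itv (@intoo_split f l v u) ?fS// opprD addNKr.
Qed.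

Lemma near_oo l r x : l < x < r -> \forall y \near x, l < y < r.
Proof.
move=> lxr; have : x \in `]l, r[ by rewrite in_itv.
by move=> /near_in_itvoo; apply: filterS => y; rewrite in_itv.
Qed.

Lemma intoo_near f l r x : leb.-integrable `]l, r[ (EFin \o f) -> l < x < r ->
  \forall y \near x, intoo f l y = \int[leb]_(t in `]l, y]) f t.
Proof.
move=> fi /andP[lx xr]; near=> y.
rewrite -Rintegral_itv_bndo_bndc//; apply: integrable_sub_oo fi _ _ => //.
by near: y; exact: lt_le_nbhsl.
Unshelve. all: by end_near. Qed.

(** Continuity of the parameterized integral is a statement about segments, so it is applied on
    [[u, v]], whose ends are the midpoints between [x] and the ends of the interval. *)
Lemma intoo_continuous f l r x : leb.-integrable `]l, r[ (EFin \o f) ->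
  l < x < r -> {for x, continuous (intoo f l)}.
Proof.
move=> fi /andP[lx xr].
pose u := (l + x) / 2; pose v := (x + r) / 2.
have [lu ux xv vr] : [/\ l < u, u < x, x < v & v < r] by rewrite /u /v; split; lra.
have fuv : leb.-integrable `[u, v] (EFin \o f).
  apply: integrableS fi => //; apply: subset_itv; rewrite bnd_simp//.
have /(continuous_within_itvP _ (lt_trans ux xv))[+ _ _] :=
  @parameterized_integral_continuous R u v f (ltW (lt_trans ux xv)) fuv.
move=> /(_ x); rewrite in_itv/= ux xv => /(_ isT) Pc.
rewrite /prop_for /continuous_at.
suff E : \forall y \near x, intoo f l u + parameterized_integral leb u y f = intoo f l y.
  have Ex := nbhs_singleton E.
  rewrite -[X in _ --> X]Ex.
  apply: cvg_trans; last exact: (cvgD (cvg_cst (intoo f l u)) Pc).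
  exact: near_eq_cvg.
near=> y.
have /andP[uy yv] : u < y < v by near: y; apply: near_oo; rewrite ux xv.
rewrite (@intoo_split f l u y) ?(ltW lu) ?(ltW uy)//; last first.
  by apply: integrable_sub_oo fi _ _ => //; lra.
congr +%R; rewrite /parameterized_integral /intoo.
rewrite -Rintegral_itv_obnd_cbnd; last first.
  by apply: integrableS fuv => //; apply: subset_itv; rewrite bnd_simp// ltW.
rewrite -Rintegral_itv_bndo_bndc//.
by apply: integrable_sub_oo fi _ _; lra.
Unshelve. all: by end_near. Qed.

Lemma is_derive_intoo f l r x : leb.-integrable `]l, r[ (EFin \o f) ->
  l < x < r -> {for x, continuous f} -> is_derive x 1 (intoo f l) (f x).
Proof.
move=> fi lxr fx; have /andP[lx xr] := lxr.
pose v := (x + r) / 2.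
have [xv vr] : x < v /\ v < r by rewrite /v; split; lra.
have fv : leb.-integrable [set` Interval (BRight l) (BRight v)] (EFin \o f).
  by apply: integrableS fi => //; apply: subset_itv; rewrite bnd_simp.
have [dF F'] := @continuous_FTC1 R f (BRight l) x v xv fv lx fx.
apply: (@near_eq_is_derive _ _ _ (fun y => \int[leb]_(t in `]l, y]) f t)).
- by have := intoo_near fi lxr; apply: filterS => ? ->.
- by apply: DeriveDef; [exact: dF|rewrite -derive1E; exact: F'].
Qed.

Lemma intoo_ge0 f l r : (forall x, l < x < r -> 0 <= f x) -> 0 <= intoo f l r.
Proof. by move=> f0; apply: Rintegral_ge0 => x; rewrite /= in_itv; exact: f0. Qed.

Lemma le_intoo f g l r : leb.-integrable `]l, r[ (EFin \o f) ->
  leb.-integrable `]l, r[ (EFin \o g) ->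
  (forall x, l < x < r -> f x <= g x) -> intoo f l r <= intoo g l r.
Proof.
move=> fi gi fg; apply: le_Rintegral => // x.
Qed.

Lemma eq_intoo f g l r : (forall x, l < x < r -> f x = g x) ->
  intoo f l r = intoo g l r.
Proof.
by move=> fg; apply: eq_Rintegral => x; rewrite inE /= in_itv; exact: fg.
Qed.

Lemma integrable_scale (k : R) f l r : leb.-integrable `]l, r[ (EFin \o f) ->
  leb.-integrable `]l, r[ (EFin \o (fun x => k * f x)).
Proof.
move=> fi; have := @integrableZl _ _ _ leb `]l, r[%classic (measurable_itv _) k _ fi.
by apply: eq_integrable.
Qed.

Lemma integrable_lincomb (k h : R) f g l r :
  leb.-integrable `]l, r[ (EFin \o f) -> leb.-integrable `]l, r[ (EFin \o g) ->
  leb.-integrable `]l, r[ (EFin \o (fun x => k * f x + h * g x)).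
Proof.
move=> fi gi.
have := @integrableD _ _ _ leb `]l, r[%classic (measurable_itv _) _ _
  (integrable_scale k fi) (integrable_scale h gi).
by apply: eq_integrable.
Qed.

Lemma intoo_lincomb (k h : R) f g l r : leb.-integrable `]l, r[ (EFin \o f) ->
  leb.-integrable `]l, r[ (EFin \o g) ->
  intoo (fun x => k * f x + h * g x) l r = k * intoo f l r + h * intoo g l r.
Proof.
move=> fi gi; rewrite /intoo RintegralD//; last 2 first.
- exact: integrable_scale.
- exact: integrable_scale.
by rewrite !RintegralZl.
Qed.

Lemma le_norm_intoo f l r : leb.-integrable `]l, r[ (EFin \o f) ->
  `|intoo f l r| <= intoo (fun x => `|f x|) l r.
Proof. by move=> fi; apply: le_normr_Rintegral. Qed.

(* [V] is bisected by the intermediate value theorem: each halving of the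
   increment of [V] improves the constant by a factor 2. *)
Lemma constant_of_quadratic_increments (D V : R -> R) (C u v : R) : u <= v ->
  {within `[u, v], continuous V} ->
  (forall x y, u <= x -> x <= y -> y <= v -> V x <= V y) ->
  (forall x y, u <= x -> x <= y -> y <= v ->
     `|D y - D x| <= C * (V y - V x) ^+ 2) ->
  D v = D u.
Proof.
move=> uv Vc Vh DV.
have bisect n : forall x y, u <= x -> x <= y -> y <= v ->
    `|D y - D x| <= C / 2 ^+ n * (V y - V x) ^+ 2.
  elim: n => [|n IH] x y ux xy yv; first by rewrite expr0 divr1 DV.
  have Vxy := Vh _ _ ux xy yv.
  have [m] : exists2 m, m \in `[x, y] & V m = (V x + V y) / 2.
    apply: IVT => //; last by rewrite min_l// max_r//; lra.
    by apply: continuous_subspaceW Vc; apply: subset_itv; rewrite bnd_simp.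
  rewrite in_itv/= => /andP[xm my] Vm.
  have -> : D y - D x = (D y - D m) + (D m - D x) by ring.
  apply: (le_trans (ler_normD _ _)).
  have h1 := IH m y (le_trans ux xm) my yv.
  have h2 := IH x m ux xm (le_trans my yv).
  have -> : C / 2 ^+ n.+1 * (V y - V x) ^+ 2 =
     C / 2 ^+ n * (V y - V m) ^+ 2 + C / 2 ^+ n * (V m - V x) ^+ 2.
    rewrite Vm exprS; field.
    by rewrite expf_neq0// pnatr_eq0.
  exact: lerD.
apply/eqP; rewrite -subr_eq0 -normr_le0.
have lim0 : (C * (V v - V u) ^+ 2) * (2^-1) ^+ n @[n --> \oo] --> 0.
  rewrite -[X in _ --> X](mulr0 (C * (V v - V u) ^+ 2)).
  by apply: cvgMl_tmp; apply: cvg_expr; rewrite ger0_norm//; lra.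
apply: (cvgr_to_ge lim0).
near=> n; apply: (le_trans (bisect n u v (lexx _) uv (lexx _))).
by rewrite exprVn mulrAC.
Unshelve. all: by end_near. Qed.

End open_interval_integral.

(** * The exponential of an absolutely continuous function *)

Section exponential_of_primitive.
Context {R : realType}.
Notation leb := (@lebesgue_measure R).
Implicit Types (f Phi : R -> R) (l r u v x y : R).

Lemma integrable_mul_bounded f (g : R -> R) (B : R) l r :
  leb.-integrable `]l, r[ (EFin \o f) -> measurable_fun `]l, r[ g ->
  (forall x, l < x < r -> `|g x| <= B) ->
  leb.-integrable `]l, r[ (EFin \o (fun x => f x * g x)).
Proof.
move=> fi gm gB.
have /measurable_EFinP fm := measurable_int leb fi.
have Bfi : leb.-integrable `]l, r[ (EFin \o (fun x => B * `|f x|)).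
  by apply: integrable_scale; exact: integrable_norm.
apply: le_integrable Bfi => //.
  by apply/measurable_EFinP; exact: measurable_funM.
move=> x; rewrite /= in_itv/= => /gB gxB; rewrite lee_fin.
rewrite normrM mulrC [leRHS]ger0_norm; last first.
  by rewrite mulr_ge0// (le_trans _ gxB).
by rewrite ler_wpM2r.
Qed.

Lemma continuous_measurable_oo (g : R -> R) l r :
  (forall x, l < x < r -> {for x, continuous g}) -> measurable_fun `]l, r[ g.
Proof.
move=> gc; apply: open_continuous_measurable_fun; first exact: interval_open.
by move=> x; rewrite inE /= in_itv; exact: gc.
Qed.

Lemma expR_sub_le (s t : R) : expR s - expR t <= expR s * (s - t).
Proof.
have -> : expR s - expR t = expR s * (1 - expR (t - s)).
  by rewrite mulrBr mulr1 -expRD subrKC.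
rewrite ler_wpM2l ?expR_ge0//; have := expR_ge1Dx (t - s); lra.
Qed.

Lemma expR_lipschitz (s t beta : R) : s <= beta -> t <= beta ->
  `|expR s - expR t| <= expR beta * `|s - t|.
Proof.
wlog : s t / t <= s => [H sb tb|ts sb _].
  have [ts|/ltW st] := leP t s; first exact: H.
  by rewrite distrC [`|s - t|]distrC; exact: H.
rewrite !ger0_norm ?subr_ge0 ?ler_expR//.
by apply: (le_trans (expR_sub_le s t)); rewrite ler_wpM2r ?subr_ge0 ?ler_expR.
Qed.

(** The constant 1 in place of the sharp 1/2 is enough: by convexity the remainder is at most
    [(expR s - expR t) * (s - t)], and the Lipschitz bound does the rest. *)
Lemma expR_taylor1 (s t beta : R) : s <= beta -> t <= beta ->
  `|expR s - expR t - expR t * (s - t)| <= expR beta * (s - t) ^+ 2.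
Proof.
move=> sb tb; rewrite ger0_norm; last first.
  have := expR_sub_le t s; lra.
have h := expR_lipschitz sb tb.
apply: (@le_trans _ _ ((expR s - expR t) * (s - t))).
  have := expR_sub_le s t; lra.
apply: (le_trans (ler_norm _)); rewrite normrM -[(s - t) ^+ 2]real_normK ?num_real// expr2 mulrA.
by rewrite ler_wpM2r.
Qed.

(** With [V] the integral of [|f|], the difference [D] between [expR (Phi x)] and the integral from
    [u] to [x] has increments of order [(V y - V x) ^+ 2], hence is constant. This replaces a
    pointwise derivative, which a merely integrable [f] does not provide. *)
Lemma expR_primitive f Phi l r u v : leb.-integrable `]l, r[ (EFin \o f) ->
  (forall x y, l < x -> x <= y -> y < r -> Phi y - Phi x = intoo f x y) ->
  l < u -> u <= v -> v < r ->
  expR (Phi v) - expR (Phi u) = intoo (fun x => f x * expR (Phi x)) u v.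
Proof.
move=> fi PhiE lu uv vr.
pose V := intoo (fun x => `|f x|) l.
have nfi : leb.-integrable `]l, r[ (EFin \o (fun x => `|f x|)).
  exact: integrable_norm.
have VE x y : l < x -> x <= y -> y < r -> V y - V x = intoo (fun x => `|f x|) x y.
  move=> lx xy yr; rewrite /V (@intoo_split _ _ l x y) ?(ltW lx)//; last first.
    by apply: integrable_sub_oo nfi _ _ => //; exact: ltW.
  by rewrite addrC addKr.
have Vh x y : l < x -> x <= y -> y < r -> V x <= V y.
  by move=> lx xy yr; rewrite -subr_ge0 VE//; exact: intoo_ge0.
have PhiV x y : l < x -> x <= y -> y < r -> `|Phi y - Phi x| <= V y - V x.
  move=> lx xy yr; rewrite PhiE// VE//; apply: le_norm_intoo.
  by apply: integrable_sub_oo fi _ _; exact: ltW.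
have Phic x : l < x < r -> {for x, continuous Phi}.
  move=> lxr; have /andP[lx xr] := lxr.
  pose z := (l + x) / 2; have [lz zx] : l < z /\ z < x by rewrite /z; split; lra.
  rewrite /prop_for /continuous_at.
  have E : \forall y \near x, Phi z - intoo f l z + intoo f l y = Phi y.
    have : z < x < r by rewrite zx.
    move=> /near_oo; apply: filterS => y /andP[zy yr].
    have := PhiE z y lz (ltW zy) yr.
    rewrite (@intoo_split _ f l z y) ?ltW//; first by lra.
    by apply: integrable_sub_oo fi _ _ => //; exact: ltW.
  have Ex := nbhs_singleton E.
  rewrite -[X in _ --> X]Ex.
  apply: cvg_trans; last first.
    exact: (cvgD (cvg_cst (Phi z - intoo f l z)) (intoo_continuous fi lxr)).
  exact: near_eq_cvg.
pose e x := expR (Phi x).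
have ec x : l < x < r -> {for x, continuous e}.
  by move=> /Phic Px; apply: continuous_comp => //; exact: continuous_expR.
(* An upper bound for [Phi] on [[u, v]], since [Phi] varies by at most the increment of [V]. *)
pose beta := Phi u + (V v - V u).
have Phib x : u <= x -> x <= v -> Phi x <= beta.
  move=> ux xv; rewrite /beta.
  have := PhiV u x lu ux (le_lt_trans xv vr).
  have := Vh x v (lt_le_trans lu ux) xv vr.
  by rewrite ler_norml => h /andP[]; lra.
have eB x : u <= x -> x <= v -> `|e x| <= expR beta.
  by move=> ux xv; rewrite ger0_norm ?expR_ge0// ler_expR Phib.
have fsub x y : u <= x -> y <= v -> leb.-integrable `]x, y[ (EFin \o f).
  by move=> ux yv; apply: integrable_sub_oo fi _ _; lra.
have fei x y : u <= x -> y <= v ->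
    leb.-integrable `]x, y[ (EFin \o (fun t => f t * e t)).
  move=> ux yv; apply: (@integrable_mul_bounded _ _ (expR beta)); first exact: fsub.
    by apply: continuous_measurable_oo => t /andP[xt ty]; apply: ec; lra.
  by move=> t /andP[xt ty]; apply: eB; lra.
pose D x := e x - intoo (fun t => f t * e t) u x.
suff : D v = D u by rewrite /D intoo_id /e; lra.
(* One [expR beta] pays for the Taylor remainder, the other for freezing [e t] at [e x] under the
   integral. *)
apply: (@constant_of_quadratic_increments _ D V (2 * expR beta)) => //.
- apply: continuous_in_subspaceT => x; rewrite inE/= in_itv/= => /andP[ux xv].
  by apply: (intoo_continuous nfi); lra.
- by move=> x y ux xy yv; apply: Vh; lra.
move=> x y ux xy yv.
have [lx yr] : l < x /\ y < r by split; lra.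
set d := V y - V x.
have d0 : 0 <= d by rewrite subr_ge0; exact: Vh.
have DE : D y - D x = (e y - e x - e x * (Phi y - Phi x))
    - intoo (fun t => f t * (e t - e x)) x y.
  have -> : intoo (fun t => f t * (e t - e x)) x y =
      intoo (fun t => 1 * (f t * e t) + (- e x) * f t) x y.
    by apply: eq_intoo => t _; ring.
  rewrite intoo_lincomb ?fei ?fsub// -PhiE// /D.
  by rewrite (@intoo_split _ _ u x y) ?fei//; ring.
rewrite DE; apply: (le_trans (ler_normB _ _)).
have -> : 2 * expR beta * d ^+ 2 = expR beta * d ^+ 2 + expR beta * d * d by ring.
apply: lerD.
  apply: (le_trans (expR_taylor1 (beta := beta) _ _)); try by apply: Phib; lra.
  rewrite ler_wpM2l ?expR_ge0// -real_normK ?num_real// lerXn2r ?nnegrE//.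
  exact: PhiV.
have fi' : leb.-integrable `]x, y[ (EFin \o (fun t => f t * (e t - e x))).
  have : leb.-integrable `]x, y[ (EFin \o (fun t => 1 * (f t * e t) + (- e x) * f t)).
    by apply: integrable_lincomb; [exact: fei|exact: fsub].
  by apply: eq_integrable => // t _ /=; congr EFin; ring.
apply: (le_trans (le_norm_intoo fi')).
rewrite [X in _ * X](VE x y)//.
have -> : expR beta * d * intoo (fun t => `|f t|) x y =
   intoo (fun t => expR beta * d * `|f t| + 0 * f t) x y.
  rewrite intoo_lincomb ?fsub ?mul0r ?addr0//.
  by apply: integrable_sub_oo nfi _ _; exact: ltW.
apply: le_intoo; first exact: integrable_norm.
  apply: integrable_lincomb; last exact: fsub.
  by apply: integrable_sub_oo nfi _ _; exact: ltW.
move=> t /andP[xt ty]; rewrite mul0r addr0 normrM mulrC ler_wpM2r//.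
apply: (le_trans (expR_lipschitz (beta := beta) _ _)); try by apply: Phib; lra.
rewrite ler_wpM2l ?expR_ge0//.
apply: (le_trans (PhiV _ _ _ _ _)); try by lra.
by rewrite /d lerD2r; apply: Vh; lra.
Qed.

End exponential_of_primitive.

(** * Unimodal functions *)

Section shapes.
Context {R : realType} (a : R) (b : \bar R).
Implicit Types (f : R -> R) (u v x y m : R).
Local Notation I := (state_space a b).

Lemma state_spaceP x : I x <-> a < x /\ (x%:E < b)%E.
Proof. by rewrite /state_space /ooint /= lte_fin; split => [/andP//|[-> ->]]. Qed.

Lemma state_space_gt x : I x -> a < x.
Proof. by move=> /state_spaceP[]. Qed.

Lemma state_space_down x y : I y -> a < x -> x <= y -> I x.
Proof.
move=> /state_spaceP[_ yb] ax xy; apply/state_spaceP; split => //.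
by apply: le_lt_trans yb; rewrite lee_fin.
Qed.

Lemma state_space_mid x y z : I x -> I z -> x <= y -> y <= z -> I y.
Proof.
by move=> /state_space_gt ax Iz xy yz; apply: state_space_down Iz _ yz; exact: lt_le_trans xy.
Qed.

Lemma state_space_up x : I x -> exists2 y, I y & x < y.
Proof.
move=> /state_spaceP[ax xb].
have [y xy yb] : exists2 y, x < y & (y%:E < b)%E.
  case: b xb => [r| |] //; last by exists (x + 1); rewrite ?ltry//; lra.
  by rewrite lte_fin => xr; exists ((x + r) / 2); rewrite ?lte_fin; lra.
by exists y => //; apply/state_spaceP; split => //; exact: lt_trans xy.
Qed.

(** The shape hypotheses concern open intervals; this lemma and its mirror image carry inequalities
    to the break points. *)
Lemma le_of_left_limit f u m k : {for m, continuous f} -> u < m ->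
  (forall v, u < v -> v < m -> k <= f v) -> k <= f m.
Proof.
move=> fc um H; apply: (cvgr_to_ge (cvg_at_left_filter fc)).
near=> v; apply: H; last by near: v; exact: nbhs_left_lt.
by near: v; exact: nbhs_left_gt.
Unshelve. all: by end_near. Qed.

Lemma ge_of_right_limit f m v k : {for m, continuous f} -> m < v ->
  (forall u, m < u -> u < v -> f u <= k) -> f m <= k.
Proof.
move=> fc mv H; apply: (cvgr_to_le (cvg_at_right_filter fc)).
near=> u; apply: H; first by near: u; exact: nbhs_right_gt.
by near: u; exact: nbhs_right_lt.
Unshelve. all: by end_near. Qed.

(** By continuity at the break points [f] is nondecreasing on [(a, x2]]. A drop from [u1] to [u2]
    therefore forces [x2 < u2], and from there on [f] decreases strictly. The three-point form is
    the one used for averages. *)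
Lemma strict_hump_shape f (x1 x2 : R) : {in I, continuous f} ->
  I x1 -> I x2 -> x1 <= x2 ->
  strictly_increasing_on (ooint a%:E x1%:E) f ->
  constant_on (ooint x1%:E x2%:E) f ->
  strictly_decreasing_on (ooint x2%:E b) f ->
  forall u1 u2 u3, I u1 -> I u3 -> u1 < u2 -> u2 < u3 ->
    f u2 < f u1 -> f u3 < f u2.
Proof.
move=> fc I1 I2 x12 inc cst dec u1 u2 u3 Iu1 Iu3 u12 u23.
have ax1 := state_space_gt I1.
have fcx x : I x -> {for x, continuous f} by move=> Ix; apply: fc; rewrite inE.
have incE u v : a < u -> u < v -> v < x1 -> f u <= f v.
  move=> au uv vx; apply/ltW/inc => //; rewrite inE /ooint/= !lte_fin; apply/andP; split; lra.
have cstE u v : x1 < u -> u < x2 -> x1 < v -> v < x2 -> f u = f v.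
  by move=> *; apply: cst; rewrite inE /ooint/= !lte_fin; apply/andP; split; lra.
have le1 u : a < u -> u < x1 -> f u <= f x1.
  move=> au ux; apply: (le_of_left_limit (fcx _ I1) ux) => v uv vx.
  exact: incE.
have le2 v : x1 < v -> v < x2 -> f x1 <= f v.
  move=> xv vx; apply: (ge_of_right_limit (fcx _ I1) xv) => w xw wv.
  by rewrite (cstE w v) //; lra.
have le3 u : x1 < u -> u < x2 -> f u <= f x2.
  move=> xu ux; apply: (le_of_left_limit (fcx _ I2) ux) => w uw wx.
  by rewrite (cstE u w) //; lra.
have le13 : f x1 <= f x2.
  move: x12; rewrite le_eqVlt => /predU1P[->//|x12'].
  by apply: (@le_trans _ _ (f ((x1 + x2) / 2))); [apply: le2|apply: le3]; lra.
have incx2 u v : a < u -> u < v -> v <= x2 -> f u <= f v.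
  move=> au uv vx2.
  have [vx1|x1v|vE] := ltgtP v x1; [exact: incE| |by rewrite vE; apply: le1; rewrite -?vE].
  have x1fv : f x1 <= f v.
    by move: vx2; rewrite le_eqVlt => /predU1P[->//|vx2]; exact: le2.
  have [ux1|x1u|->//] := ltgtP u x1; first by apply: le_trans x1fv; exact: le1.
  move: vx2; rewrite le_eqVlt => /predU1P[vE|vx2]; first by rewrite vE; apply: le3; rewrite -?vE.
  by rewrite (cstE u v) //; lra.
have [u2x|xu2] := leP u2 x2.
  by rewrite ltNge (incx2 _ _ (state_space_gt Iu1) u12 u2x).
move=> _; apply: dec => //; rewrite inE /ooint/= lte_fin.
  have /state_spaceP[_ u3b] := Iu3.
  by rewrite u3b andbT; lra.
have /state_spaceP[_ u2b] := state_space_mid Iu1 Iu3 (ltW u12) (ltW u23).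
by rewrite xu2.
Qed.

(** If [f] exceeded [f u2] at both [u1] and [u3], so would every convex combination of these two
    values, whereas concavity bounds the one with barycenter [u2] by [f u2]. *)
Lemma concave_on_ge_min f (D : set R) u1 u2 u3 : concave_on D f ->
  D u1 -> D u3 -> u1 < u2 -> u2 < u3 -> f u2 < f u1 -> f u3 <= f u2.
Proof.
move=> fD D1 D3 u12 u23 f21.
pose t := (u3 - u2) / (u3 - u1).
have d0 : 0 < u3 - u1 by lra.
have t01 : 0 <= t <= 1.
  by rewrite /t divr_ge0 ?ler_pdivrMr ?mul1r //; lra.
have t0 : 0 < t by rewrite divr_gt0//; lra.
have t1 : t < 1 by rewrite ltr_pdivrMr// mul1r; lra.
have [t' t'E] : exists t' : {i01 R}, t'%:num = t.
  by exists (Itv01 (andP t01).1 (andP t01).2).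
have := fD t' u1 u3; rewrite !inE => /(_ D1 D3).
have u2E : t * u1 + (1 - t) * u3 = u2 by rewrite /t; field; lra.
have -> : conv t' (u1 : convex_lmodType R^o) u3 = u2.
  by rewrite -u2E -t'E.
rewrite convRE t'E /unstable.onem => H; rewrite leNgt; apply/negP => f23.
have : t * (f u1 - f u2) + (1 - t) * (f u3 - f u2) > 0.
  by apply: addr_gt0; apply: mulr_gt0; lra.
move: H; rewrite /=; lra.
Qed.

Lemma increasing_concave_shape f (x1 : R) : {in I, continuous f} -> I x1 ->
  strictly_increasing_on (ooint a%:E x1%:E) f ->
  concave_on (ooint x1%:E b) f ->
  forall u1 u2 u3, I u1 -> I u3 -> u1 < u2 -> u2 < u3 ->
    f u2 < f u1 -> f u3 <= f u2.
Proof.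
move=> fc I1 inc conc u1 u2 u3 Iu1 Iu3 u12 u23 f21.
have fcx x : I x -> {for x, continuous f} by move=> Ix; apply: fc; rewrite inE.
have au1 := state_space_gt Iu1.
have /state_spaceP[_ u3b] := Iu3.
have incE u v : a < u -> u < v -> v < x1 -> f u <= f v.
  move=> au uv vx; apply/ltW/inc => //; rewrite inE /ooint/= !lte_fin; apply/andP; split; lra.
have le1 u : a < u -> u < x1 -> f u <= f x1.
  move=> au ux; apply: (le_of_left_limit (fcx _ I1) ux) => v uv vx.
  exact: incE.
have D3 : x1 < u2 -> ooint x1%:E b u3.
  by move=> x1u2; rewrite /ooint/= lte_fin u3b andbT; lra.
have Dv v : x1 < v -> v < u3 -> ooint x1%:E b v.
  move=> x1v vu3; rewrite /ooint/= lte_fin x1v/=.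
  by apply: lt_trans u3b; rewrite lte_fin.
have [u2x|x1u2|u2E] := ltgtP u2 x1.
- by have := incE _ _ au1 u12 u2x; lra.
- have [x1u1|u1x1] := ltP x1 u1.
    by apply: (concave_on_ge_min conc) f21 => //; [apply: Dv|apply: D3]; lra.
  have f2x : f u2 < f x1.
    move: u1x1; rewrite le_eqVlt => /predU1P[<-//|u1x1].
    by have := le1 _ au1 u1x1; lra.
  (* The point [x1] is outside the open interval of concavity. A rise from [u2] to [u3] would keep
     [f] at most [f u2] on [(x1, u2)], hence also at [x1] by continuity, against [f2x]. *)
  rewrite leNgt; apply/negP => f23.
  suff : f x1 <= f u2 by rewrite leNgt f2x.
  apply: (ge_of_right_limit (fcx _ I1) x1u2) => v x1v vu2.
  rewrite leNgt; apply/negP => f2v.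
  have := @concave_on_ge_min f _ v u2 u3 conc (Dv v x1v _) (D3 x1u2) vu2 u23 f2v.
  by rewrite leNgt f23 => /(_ (lt_trans vu2 u23)).
- by have := le1 _ au1 (_ : u1 < x1); rewrite -u2E => /(_ u12); lra.
Qed.

End shapes.

(** * Averages against a density *)

Section averages.
Context {R : realType} (a : R) (b : \bar R) (m : R -> R).
Notation leb := (@lebesgue_measure R).
Implicit Types (f g : R -> R) (x y z k : R).
Local Notation I := (state_space a b).

(** A positive function with zero integral would vanish almost everywhere, so that the nonempty
    interval []l, r[] would be a null set. *)
Lemma intoo_gt0 f l r : l < r -> leb.-integrable `]l, r[ (EFin \o f) ->
  (forall x, l < x < r -> 0 < f x) -> 0 < intoo f l r.
Proof.
move=> lr fi f0; rewrite lt_neqAle intoo_ge0 ?andbT; last by move=> x /f0/ltW.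
apply/eqP => fE.
have : (\int[leb]_(x in `]l, r[) `|(EFin \o f) x| = 0)%E.
  rewrite -[LHS]fineK; last first.
    by have /integrableP[_ ?] := fi; rewrite ge0_fin_numE// integral_ge0.
  transitivity (intoo f l r)%:E; last by rewrite -fE.
  rewrite /intoo /Rintegral; congr (fine _)%:E.
  apply: eq_integral => x; rewrite inE/= in_itv/= => /f0 fx.
  by rewrite gtr0_norm.
move=> /(proj1 (ae_eq_integral_abs leb (measurable_itv _) (measurable_int leb fi))).
move=> [N [mN N0 sN]].
have : (leb `]l, r[%classic <= leb N)%E.
  apply: le_measure; rewrite ?inE//.
  move=> x /= xlr; apply: sN => /= /(_ xlr)/eqP.
  by rewrite eqe; move: xlr; rewrite in_itv/= => /f0; case: ltgtP.
by rewrite N0 lebesgue_measure_itv/= lte_fin lr -EFinD lee_fin subr_le0 leNgt lr.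
Qed.

Hypothesis m_gt0 : forall x, I x -> 0 < m x.
Hypothesis m_int : forall x, I x -> leb.-integrable `]a, x[ (EFin \o m).

Definition weightable f :=
  forall x, I x -> leb.-integrable `]a, x[ (EFin \o (fun u => f u * m u)).

Definition wint f x := intoo (fun u => f u * m u) a x.
Definition mass x := intoo m a x.
Definition avg f x := wint f x / mass x.

Lemma mass_gt0 x : I x -> 0 < mass x.
Proof.
move=> Ix; apply: intoo_gt0; [exact: state_space_gt Ix|exact: m_int|].
by move=> u /andP[au ux]; apply/m_gt0/(state_space_down Ix au)/ltW.
Qed.

Lemma avgM f x : I x -> wint f x = avg f x * mass x.
Proof. by move=> Ix; rewrite /avg divfK// gt_eqF// mass_gt0. Qed.

Lemma avg_lincomb (p q : R) f g x : I x -> weightable f -> weightable g ->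
  avg (fun u => p * f u + q * g u) x = p * avg f x + q * avg g x.
Proof.
move=> Ix fw gw; rewrite /avg !mulrA -mulrDl; congr (_ / _).
rewrite /wint -(intoo_lincomb p q (fw x Ix) (gw x Ix)).
by apply: eq_intoo => u _; ring.
Qed.

Lemma weightable_lincomb (p q : R) f g : weightable f -> weightable g ->
  weightable (fun u => p * f u + q * g u).
Proof.
move=> fw gw x Ix; have := integrable_lincomb p q (fw x Ix) (gw x Ix).
by apply: eq_integrable => // u _ /=; congr EFin; ring.
Qed.

Lemma wint_increment f x y k : weightable f -> a <= x -> x <= y -> I y ->
  (wint f y - wint f x) - k * (mass y - mass x)
    = intoo (fun u => (f u - k) * m u) x y.
Proof.
move=> fw ax xy Iy.
rewrite /wint /mass (@intoo_split _ _ a x y ax xy (fw y Iy)).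
rewrite (@intoo_split _ _ a x y ax xy (m_int Iy)).
have -> : intoo (fun u => (f u - k) * m u) x y =
    intoo (fun u => 1 * (f u * m u) + (- k) * m u) x y.
  by apply: eq_intoo => u _; ring.
rewrite intoo_lincomb; first by ring.
- exact: integrable_sub_oo (fw y Iy) ax (lexx y).
- exact: integrable_sub_oo (m_int Iy) ax (lexx y).
Qed.

Lemma integrable_increment f x y k : weightable f -> a <= x -> I y ->
  leb.-integrable `]x, y[ (EFin \o (fun u => (f u - k) * m u)).
Proof.
move=> fw ax Iy; apply: (integrable_sub_oo _ ax (lexx y)).
have := integrable_lincomb 1 (- k) (fw y Iy) (m_int Iy).
by apply: eq_integrable => // u _ /=; congr EFin; ring.
Qed.

Lemma wint_increment_le f x y k : weightable f -> a <= x -> x <= y -> I y ->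
  (forall u, x < u < y -> f u <= k) ->
  wint f y - wint f x <= k * (mass y - mass x).
Proof.
move=> fw ax xy Iy fk; rewrite -subr_le0 (wint_increment _ fw ax xy Iy).
rewrite -oppr_ge0.
(* The zero summand only brings the negation into the form of [intoo_lincomb]. *)
have -> : - intoo (fun u => (f u - k) * m u) x y =
    intoo (fun u => (-1) * ((f u - k) * m u) + 0 * ((f u - k) * m u)) x y.
  by rewrite intoo_lincomb ?integrable_increment//; ring.
apply: intoo_ge0 => u xuy; rewrite mul0r addr0 mulrA.
apply: mulr_ge0; first by have := fk u xuy; lra.
by apply/ltW/m_gt0; apply: (state_space_down Iy); lra.
Qed.

Lemma wint_increment_ge f x y k : weightable f -> a <= x -> x <= y -> I y ->
  (forall u, x < u < y -> k <= f u) ->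
  k * (mass y - mass x) <= wint f y - wint f x.
Proof.
move=> fw ax xy Iy fk; rewrite -subr_ge0 (wint_increment _ fw ax xy Iy).
apply: intoo_ge0 => u xuy; apply: mulr_ge0; first by have := fk u xuy; lra.
by apply/ltW/m_gt0; apply: (state_space_down Iy); lra.
Qed.

(** A mean value property: were [f < k] on all of [(x, y)], positivity of [m] would make the
    opposite inequality of increments strict. *)
Lemma exists_ge_of_increment f x y k : weightable f -> a <= x -> x < y -> I y ->
  k * (mass y - mass x) <= wint f y - wint f x ->
  exists2 u, x < u < y & k <= f u.
Proof.
move=> fw ax xy Iy; rewrite -subr_ge0 (wint_increment _ fw ax (ltW xy) Iy) => H.
apply: contrapT => nex.
have fk u : x < u < y -> f u < k.
  by move=> xuy; rewrite ltNge; apply/negP => ku; apply: nex; exists u.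
suff : 0 < intoo (fun u => (-1) * ((f u - k) * m u) + 0 * ((f u - k) * m u)) x y.
  by rewrite intoo_lincomb ?integrable_increment//; lra.
apply: intoo_gt0 => //.
  by apply: integrable_lincomb; exact: integrable_increment.
move=> u xuy; rewrite mul0r addr0 mulrA.
apply: mulr_gt0; first by have := fk u xuy; lra.
by apply/m_gt0; apply: (state_space_down Iy); lra.
Qed.

Lemma exists_le_of_increment f x y k : weightable f -> a <= x -> x < y -> I y ->
  wint f y - wint f x <= k * (mass y - mass x) ->
  exists2 u, x < u < y & f u <= k.
Proof.
move=> fw ax xy Iy; rewrite -subr_le0 (wint_increment _ fw ax (ltW xy) Iy) => H.
apply: contrapT => nex.
have fk u : x < u < y -> k < f u.
  by move=> xuy; rewrite ltNge; apply/negP => ku; apply: nex; exists u.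
suff : 0 < intoo (fun u => (f u - k) * m u) x y by lra.
apply: intoo_gt0 => //; first exact: integrable_increment.
move=> u xuy; apply: mulr_gt0; first by have := fk u xuy; lra.
by apply/m_gt0; apply: (state_space_down Iy); lra.
Qed.

Lemma wint_left f : wint f a = 0. Proof. exact: intoo_id. Qed.
Lemma mass_left : mass a = 0. Proof. exact: intoo_id. Qed.

Lemma mass_ndecr x y : a <= x -> x <= y -> I y -> mass x <= mass y.
Proof.
move=> ax xy Iy; rewrite /mass (@intoo_split _ _ a x y ax xy (m_int Iy)) lerDl.
apply: intoo_ge0 => u xuy.
by apply/ltW/m_gt0; apply: (state_space_down Iy); lra.
Qed.

(** The value [f x] separates the two ranges: it dominates [f] on [(a, x)], hence also [avg f x],
    and bounds [f] from below on [(x, y)]. *)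
Lemma le_avg f x y : weightable f -> I x -> I y -> x <= y ->
  (forall u v, I u -> I v -> u <= v -> f u <= f v) -> avg f x <= avg f y.
Proof.
move=> fw Ix Iy xy fh.
have ax := state_space_gt Ix.
have Mx := mass_gt0 Ix; have My := mass_gt0 Iy.
have h1 : wint f y - wint f x >= f x * (mass y - mass x).
  apply: wint_increment_ge => //; first exact: ltW.
  move=> u /andP[xu uy]; apply: fh => //; last exact: ltW.
  by apply: (state_space_mid Ix Iy); exact: ltW.
have h2 : wint f x - wint f a <= f x * (mass x - mass a).
  apply: wint_increment_le => //; first exact: ltW.
  move=> u /andP[au ux]; apply: fh => //; last exact: ltW.
  by apply: (state_space_down Ix) => //; exact: ltW.
have Mxy : mass x <= mass y by apply: mass_ndecr => //; exact: ltW.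
move: h1 h2; rewrite wint_left mass_left !subr0 !avgM// ler_pM2r// => h1 h2.
rewrite -(ler_pM2r My); nra.
Qed.

(** The average does not rise from [x] to [y], so the mean of [f] over [(x, y)] is at most
    [avg f y]; it does not fall from [y] to [z], so the mean of [f] over [(y, z)] is at least
    [avg f z]. *)
Lemma avg_dip f x y z : weightable f -> I x -> I z -> x < y -> y < z ->
  avg f y <= avg f x -> avg f y <= avg f z ->
  exists u2 u3, [/\ x < u2 < y, y < u3 < z, f u2 <= avg f y & avg f z <= f u3].
Proof.
move=> fw Ix Iz xy yz fyx fyz.
have ax := state_space_gt Ix.
have Iy := state_space_mid Ix Iz (ltW xy) (ltW yz).
have Mx := mass_gt0 Ix; have My := mass_gt0 Iy; have Mz := mass_gt0 Iz.
have [u2 u2xy fu2] : exists2 u, x < u < y & f u <= avg f y.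
  apply: exists_le_of_increment => //; first exact: ltW.
  rewrite !avgM//; nra.
have [u3 u3yz fu3] : exists2 u, y < u < z & avg f z <= f u.
  apply: exists_ge_of_increment => //; first by lra.
  rewrite !avgM//; nra.
by exists u2, u3.
Qed.

Lemma exists_ge_avg f x : weightable f -> I x ->
  exists2 u, a < u < x & avg f x <= f u.
Proof.
move=> fw Ix; apply: exists_ge_of_increment => //; first exact: state_space_gt Ix.
by rewrite wint_left mass_left !subr0 avgM.
Qed.

(** Strict quasi-concavity starts from a weak inequality of averages, so a value strictly above the
    average is needed. If [avg f x] bounded [f] on [(a, x)], the strict increase near [a] would
    bound [f] on some [(a, v)] by the smaller [f v], and the mean would fall short of [avg f x]. *)
Lemma exists_gt_avg f x x1 : weightable f -> I x -> a < x1 ->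
  strictly_increasing_on (ooint a%:E x1%:E) f ->
  exists2 u, a < u < x & avg f x < f u.
Proof.
move=> fw Ix ax1 inc; apply: contrapT => nex.
have ax := state_space_gt Ix.
have fle u : a < u < x -> f u <= avg f x.
  by move=> aux; rewrite leNgt; apply/negP => fu; apply: nex; exists u.
pose t := Num.min x x1.
have [at_ tx tx1] : [/\ a < t, t <= x & t <= x1].
  by rewrite lt_min ax ax1 !ge_min !lexx orbT.
pose v := (a + t) / 2; pose v' := (v + t) / 2.
have [av vv' v't] : [/\ a < v, v < v' & v' < t] by rewrite /v' /v; split; lra.
have fD u : a < u -> u < t -> u \in ooint a%:E x1%:E.
  by move=> au ut; rewrite inE /ooint/= !lte_fin au/=; lra.
have fvv' : f v < f v' by apply: inc => //; apply: fD; lra.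
have fv'x : f v' <= avg f x by apply: fle; lra.
have Iv : I v by apply: (state_space_down Ix) => //; lra.
have h1 : wint f v - wint f a <= f v * (mass v - mass a).
  apply: wint_increment_le => //; first exact: ltW.
  by move=> u /andP[au uv]; apply/ltW/inc => //; apply: fD; lra.
have h2 : wint f x - wint f v <= avg f x * (mass x - mass v).
  apply: wint_increment_le => //; try by lra.
  by move=> u /andP[vu ux]; apply: fle; lra.
have Mv := mass_gt0 Iv.
move: h1 h2; rewrite wint_left mass_left !subr0 [wint f x]avgM//; nra.
Qed.

(** A dip of the average at [y] would produce a dip of [f]: a point of [(a, x)] with value at least
    [avg f x], followed by the two points of [avg_dip]. *)
Lemma avg_quasiconcave f x y z : weightable f ->
  (forall u1 u2 u3, I u1 -> I u3 -> u1 < u2 -> u2 < u3 -> f u2 < f u1 -> f u3 <= f u2) ->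
  I x -> I z -> x < y -> y < z -> avg f y < avg f x -> avg f z <= avg f y.
Proof.
move=> fw sh Ix Iz xy yz fyx; rewrite leNgt; apply/negP => fyz.
have [u1 /andP[au1 u1x] fu1] := exists_ge_avg fw Ix.
have [u2 [u3 [/andP[xu2 u2y] /andP[yu3 u3z] fu2 fu3]]] :=
  avg_dip fw Ix Iz xy yz (ltW fyx) (ltW fyz).
suff : f u3 <= f u2 by rewrite leNgt (le_lt_trans fu2 (lt_le_trans fyz fu3)).
apply: (sh u1 u2 u3); first exact: state_space_down Ix au1 (ltW u1x).
- exact: state_space_mid Ix Iz (ltW (lt_trans xy yu3)) (ltW u3z).
- exact: lt_trans u1x xu2.
- exact: lt_trans u2y yu3.
- exact: le_lt_trans fu2 (lt_le_trans fyx fu1).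
Qed.

Lemma avg_strictly_quasiconcave f x1 x y z : weightable f -> a < x1 ->
  strictly_increasing_on (ooint a%:E x1%:E) f ->
  (forall u1 u2 u3, I u1 -> I u3 -> u1 < u2 -> u2 < u3 -> f u2 < f u1 -> f u3 < f u2) ->
  I x -> I z -> x < y -> y < z -> avg f y <= avg f x -> avg f z < avg f y.
Proof.
move=> fw ax1 inc sh Ix Iz xy yz fyx; rewrite ltNge; apply/negP => fyz.
have [u1 /andP[au1 u1x] fu1] := exists_gt_avg fw Ix ax1 inc.
have [u2 [u3 [/andP[xu2 u2y] /andP[yu3 u3z] fu2 fu3]]] :=
  avg_dip fw Ix Iz xy yz fyx fyz.
suff : f u3 < f u2 by rewrite ltNge (le_trans fu2 (le_trans fyz fu3)).
apply: (sh u1 u2 u3); first exact: state_space_down Ix au1 (ltW u1x).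
- exact: state_space_mid Ix Iz (ltW (lt_trans xy yu3)) (ltW u3z).
- exact: lt_trans u1x xu2.
- exact: lt_trans u2y yu3.
- exact: le_lt_trans fu2 (le_lt_trans fyx fu1).
Qed.

End averages.

(** * Comparative statics of a family that is affine in its parameter *)

Section comparative_statics.
Context {R : realType} (a : R) (b : \bar R).
Implicit Types (q r u v x z : R).
Local Notation I := (state_space a b).
(** [l] and [D] are the derivatives in the parameter of the objective [F] and of the function [h] in
    the first-order conditions. *)
Variables (Q : set R) (F : R -> R -> R -> R) (l : R -> R -> R).
Variables (h : R -> R -> R) (D w y : R -> R).
Hypothesis Q_open : open Q.
Hypothesis F_affine : forall q r u v, F r u v = F q u v + (r - q) * l u v.
Hypothesis h_affine : forall q r x, h r x = h q x + (r - q) * D x.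
Hypothesis wy_in : forall q, Q q -> [/\ I (w q), I (y q) & w q < y q].
Hypothesis wy_max : forall q, Q q -> forall u v, I u -> I v -> u < v ->
  F q u v <= F q (w q) (y q).
Hypothesis wy_unique : forall q, Q q -> forall u v, I u -> I v -> u < v ->
  F q u v = F q (w q) (y q) -> u = w q /\ v = y q.
Hypothesis h_w : forall q, Q q -> h q (w q) = F q (w q) (y q).
Hypothesis h_y : forall q, Q q -> h q (y q) = F q (w q) (y q).
Hypothesis h_quasiconcave : forall q, Q q -> forall u v z, I u -> I z ->
  u < v -> v < z -> h q v <= h q u -> h q z < h q v.

Let Fmax q := F q (w q) (y q).
Let slope q := l (w q) (y q).

(** The maximizer for [q] is an admissible pair for [r], and its value is affine in the
    parameter. *)
Lemma Fmax_subgradient q r : Q q -> Q r -> Fmax q + (r - q) * slope q <= Fmax r.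
Proof.
move=> Qq Qr; have [Iw Iy wy] := wy_in Qq.
by rewrite /Fmax /slope -F_affine; exact: wy_max.
Qed.

Lemma Fmax_subgradient_eq q r : Q q -> Q r -> Fmax q + (r - q) * slope q = Fmax r ->
  w q = w r /\ y q = y r.
Proof.
move=> Qq Qr; have [Iw Iy wy] := wy_in Qq.
by rewrite /Fmax /slope -F_affine; exact: wy_unique.
Qed.

Lemma slope_ndecr q r : Q q -> Q r -> q <= r -> slope q <= slope r.
Proof.
move=> Qq Qr; rewrite le_eqVlt => /predU1P[->//|qr].
have := Fmax_subgradient Qq Qr; have := Fmax_subgradient Qr Qq; nra.
Qed.

(** If [h q x <= h q (w q)], strict quasi-concavity would put [h q (y q)] strictly below [h q x],
    although it equals [h q (w q)]. *)
Lemma h_inside q x : Q q -> w q < x -> x < y q -> Fmax q < h q x.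
Proof.
move=> Qq wx xy; have [Iw Iy _] := wy_in Qq.
rewrite ltNge; apply/negP => hx.
have := h_quasiconcave Qq Iw Iy wx xy; rewrite h_w// h_y// => /(_ hx).
by rewrite ltNge hx.
Qed.

Lemma h_left q x : Q q -> I x -> x < w q -> h q x < Fmax q.
Proof.
move=> Qq Ix xw; have [Iw Iy wy] := wy_in Qq.
rewrite ltNge; apply/negP => hx.
have := h_quasiconcave Qq Ix Iy xw wy; rewrite h_w// h_y// => /(_ hx).
by rewrite ltxx.
Qed.

Lemma h_right q x : Q q -> I x -> y q < x -> h q x < Fmax q.
Proof.
move=> Qq Ix yx; have [Iw Iy wy] := wy_in Qq.
by have := h_quasiconcave Qq Iw Ix wy yx; rewrite h_w// h_y//; exact.
Qed.

Lemma h_le_outside q x : Q q -> h q x <= Fmax q -> x <= w q \/ y q <= x.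
Proof.
move=> Qq hx; have [xw|wx] := leP x (w q); first by left.
by right; rewrite leNgt; apply/negP => /(h_inside Qq wx); rewrite ltNge hx.
Qed.

Lemma h_gt_inside q x : Q q -> I x -> Fmax q < h q x -> w q < x /\ x < y q.
Proof.
move=> Qq Ix hx; split; rewrite ltNge; apply/negP; rewrite le_eqVlt => /predU1P[|].
- by move=> E; move: hx; rewrite E h_w// /Fmax ltxx.
- by move=> /(h_left Qq Ix); rewrite ltNge (ltW hx).
- by move=> E; move: hx; rewrite -E h_y// /Fmax ltxx.
- by move=> /(h_right Qq Ix); rewrite ltNge (ltW hx).
Qed.

Lemma h_lt_outside q x : Q q -> h q x < Fmax q -> x < w q \/ y q < x.
Proof.
move=> Qq hx; have [|] := h_le_outside Qq (ltW hx);
  rewrite le_eqVlt => /predU1P[E|]; try by [left|right].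
- by move: hx; rewrite E h_w// /Fmax ltxx.
- by move: hx; rewrite -E h_y// /Fmax ltxx.
Qed.

Lemma near_Q q : Q q -> \forall r \near q, Q r.
Proof. by move=> Qq; apply: open_nbhs_nbhs. Qed.

Lemma near_dist q (d : R) : 0 < d -> \forall r \near q, `|q - r| < d.
Proof. by move=> d0; have := nbhsx_ballx q _ d0. Qed.

Lemma Fmax_continuous q : Q q -> {for q, continuous Fmax}.
Proof.
move=> Qq.
have [d /= d0 dQ] := (nbhs_ballP _ _).1 (near_Q Qq).
pose e := d / 2; have [e0 ed] : 0 < e /\ e < d by rewrite /e; split; lra.
have Qm : Q (q - e) by apply: dQ; rewrite /ball/= opprB addrC subrK gtr0_norm.
have Qp : Q (q + e) by apply: dQ; rewrite /ball/= opprD addNKr normrN gtr0_norm.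
(* By monotonicity [slope] lies between its values at [q - e] and [q + e], so [K] bounds it near
   [q]; the summand 1 makes [K] positive for [eps / K]. *)
pose K := `|slope (q - e)| + `|slope (q + e)| + `|slope q| + 1.
have K0 : 0 < K by rewrite /K ltr_wpDl// !addr_ge0.
rewrite /prop_for /continuous_at; apply/cvgrPdist_le => eps eps0.
near=> r.
have Qr : Q r by near: r; exact: near_Q.
have : `|q - r| < e by near: r; exact: near_dist.
rewrite ltr_distlC => /andP[qe1 qe2].
have h1 : `|q - r| < eps / K by near: r; apply: near_dist; rewrite divr_gt0.
have [re er] : q - e <= r /\ r <= q + e by split; exact: ltW.
have sm := slope_ndecr Qm Qr re; have sp := slope_ndecr Qr Qp er.
have K1 : `|slope r| <= K.
  rewrite /K ler_norml; move: sm sp.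
  have := ler_norm (slope (q + e)); have := ler_norm (- slope (q - e)).
  have := normr_ge0 (slope (q + e)); have := normr_ge0 (slope (q - e)).
  have := normr_ge0 (slope q).
  by rewrite normrN; move=> *; apply/andP; split; lra.
have K2 : `|slope q| <= K.
  by rewrite /K -addrA addrC -addrA lerDl !addr_ge0.
have lo := Fmax_subgradient Qq Qr; have hi := Fmax_subgradient Qr Qq.
have A s : `|s| <= K -> `|(q - r) * s| <= eps.
  move=> sK; rewrite normrM; apply: (@le_trans _ _ (`|q - r| * K)).
    by rewrite ler_wpM2l.
  by rewrite -ler_pdivlMr// ltW.
have := A _ K1; have := A _ K2; rewrite !ler_norml => /andP[? ?] /andP[? ?].
by apply/andP; split; nra.
Unshelve. all: by end_near. Qed.

Lemma near_signs q x x' : Q q -> h q x < Fmax q -> Fmax q < h q x' ->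
  \forall r \near q, [/\ Q r, h r x < Fmax r & Fmax r < h r x'].
Proof.
move=> Qq hx hx'.
have hc z : (fun r => h r z) r @[r --> q] --> h q z.
  have -> : (fun r => h r z) = (fun r => h q z + (r - q) * D z).
    by apply/funext => r; exact: h_affine.
  rewrite -[X in _ --> X]addr0 -(mul0r (D z)) -(subrr q).
  apply: cvgD; first exact: cvg_cst.
  apply: cvgMr_tmp; apply: cvgB; [exact: cvg_id|exact: cvg_cst].
have d1 : (fun r => Fmax r - h r x) r @[r --> q] --> Fmax q - h q x.
  by apply: cvgB; [exact: Fmax_continuous|exact: hc].
have d2 : (fun r => h r x' - Fmax r) r @[r --> q] --> h q x' - Fmax q.
  by apply: cvgB; [exact: hc|exact: Fmax_continuous].
near=> r; split; first by near: r; exact: near_Q.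
- rewrite -subr_gt0; near: r; apply: (cvgr_gt _ d1).
  by rewrite subr_gt0.
- rewrite -subr_gt0; near: r; apply: (cvgr_gt _ d2).
  by rewrite subr_gt0.
Unshelve. all: by end_near. Qed.

(* The signs of [h r - Fmax r] at [x1 < w q < x2 < y q < x3] persist for [r]
   near [q] and trap [w r] in [[x1, x2]] and [y r] in [[x2, x3]]. *)
Lemma w_continuous q : Q q -> {for q, continuous w}.
Proof.
move=> Qq; have [Iw Iy wy] := wy_in Qq.
have aw := state_space_gt Iw.
rewrite /prop_for /continuous_at; apply/cvgrPdist_le => eps eps0.
have [x1 [x1w x1e ax1]] : exists x1, [/\ x1 < w q, w q - eps < x1 & a < x1].
  exists (Num.max (w q - eps / 2) ((a + w q) / 2)).
  rewrite gt_max !lt_max; split; first by apply/andP; split; lra.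
    by apply/orP; left; lra.
  by apply/orP; right; lra.
have [x2 [wx2 x2e x2y]] : exists x2, [/\ w q < x2, x2 < w q + eps & x2 < y q].
  exists (Num.min (w q + eps / 2) ((w q + y q) / 2)).
  rewrite lt_min !gt_min; split; first by apply/andP; split; lra.
    by apply/orP; left; lra.
  by apply/orP; right; lra.
have Ix1 : I x1 by apply: (state_space_down Iw) => //; exact: ltW.
have Ix2 : I x2 by apply: (state_space_mid Iw Iy); exact: ltW.
have := near_signs Qq (h_left Qq Ix1 x1w) (h_inside Qq wx2 x2y).
apply: filterS => r [Qr hx1 hx2].
have [wr2 r2y] := h_gt_inside Qr Ix2 hx2.
have [x1r|yx1] := h_lt_outside Qr hx1.
  by rewrite ler_norml; apply/andP; split; lra.
lra.
Qed.

(** The mirror image of [w_continuous]; since [b] may be finite, [x3] is kept below a point [z] of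
    the state space. *)
Lemma y_continuous q : Q q -> {for q, continuous y}.
Proof.
move=> Qq; have [Iw Iy wy] := wy_in Qq.
rewrite /prop_for /continuous_at; apply/cvgrPdist_le => eps eps0.
have [z Iz yz] := state_space_up Iy.
have [x3 [yx3 x3e x3z]] : exists x3, [/\ y q < x3, x3 < y q + eps & x3 < z].
  exists (Num.min (y q + eps / 2) ((y q + z) / 2)).
  rewrite lt_min !gt_min; split; first by apply/andP; split; lra.
    by apply/orP; left; lra.
  by apply/orP; right; lra.
have [x2 [x2y x2e wx2]] : exists x2, [/\ x2 < y q, y q - eps < x2 & w q < x2].
  exists (Num.max (y q - eps / 2) ((w q + y q) / 2)).
  rewrite gt_max !lt_max; split; first by apply/andP; split; lra.
    by apply/orP; left; lra.
  by apply/orP; right; lra.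
have Ix3 : I x3 by apply: (state_space_mid Iy Iz); exact: ltW.
have Ix2 : I x2 by apply: (state_space_mid Iw Iy); exact: ltW.
have := near_signs Qq (h_right Qq Ix3 yx3) (h_inside Qq wx2 x2y).
apply: filterS => r [Qr hx3 hx2].
have [wr2 r2y] := h_gt_inside Qr Ix2 hx2.
have [x3r|yx3r] := h_lt_outside Qr hx3; first by lra.
by rewrite ler_norml; apply/andP; split; lra.
Qed.

(** The two subgradient inequalities squeeze the difference quotient between [slope q] and
    [slope (e + q)]; the sign of [e] decides which of them is the lower bound. *)
Lemma is_derive_Fmax q : Q q -> {for q, continuous slope} ->
  is_derive q 1 Fmax (slope q).
Proof.
move=> Qq sc.
suff H : e^-1 *: ((Fmax \o shift q) (e *: (1 : R)) - Fmax q) @[e --> 0^'] --> slope q.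
  apply: DeriveDef; first by apply/cvg_ex; exists (slope q).
  exact: cvg_lim H.
have sc0 : slope (e + q) @[e --> 0^'] --> slope q.
  apply: cvg_within_filter.
  have : e + q @[e --> (0 : R)] --> q.
    by rewrite -[X in _ --> X]add0r; apply: cvgD; [exact: cvg_id|exact: cvg_cst].
  by move=> /cvg_comp; apply.
apply/cvgrPdist_le => eps eps0; near=> e.
have e0 : e != 0 by near: e; exact: nbhs_dnbhs_neq.
have he : `|slope q - slope (e + q)| <= eps.
  by near: e; apply: (cvgrPdist_le _ _).1 sc0 _ eps0.
have Qe : Q (e + q).
  near: e; apply: nbhs_dnbhs.
  have : e + q @[e --> (0 : R)] --> q.
    by rewrite -[X in _ --> X]add0r; apply: cvgD; [exact: cvg_id|exact: cvg_cst].
  by apply; exact: near_Q.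
have lo := Fmax_subgradient Qq Qe; have hi := Fmax_subgradient Qe Qq.
apply: (le_trans _ he); rewrite /= [e *: 1]mulr1.
set g := e^-1 *: _.
have gE : Fmax (e + q) - Fmax q = e * g.
  by rewrite /g /GRing.scale/= mulrA divff// mul1r.
have {}lo : e * slope q <= e * g by rewrite -gE; move: lo; lra.
have {}hi : e * g <= e * slope (e + q).
  by rewrite -gE; move: hi; lra.
have [e_lt0|e_gt0|e_eq0] := ltgtP e 0; last by rewrite e_eq0 eqxx in e0.
- move: lo hi; rewrite !ler_nM2l// => lo hi.
  by rewrite !ger0_norm; lra.
- move: lo hi; rewrite !ler_pM2l// => lo hi.
  by rewrite !ler0_norm; lra.
Unshelve. all: by end_near. Qed.

(** Here [h] does not depend on the parameter while [Fmax] is nonincreasing, so the interval on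
    which [h] exceeds [Fmax] can only grow. *)
Lemma nested_maximizers q r : (forall x, D x = 0) ->
  (forall u v, I u -> I v -> u < v -> l u v <= 0) ->
  Q q -> Q r -> q <= r -> w r <= w q /\ y q <= y r.
Proof.
move=> D0 l0 Qq Qr; rewrite le_eqVlt => /predU1P[->//|qr].
have [Iwq Iyq wyq] := wy_in Qq; have [Iwr Iyr wyr] := wy_in Qr.
have sr : slope r <= 0 by exact: l0.
have Frq : Fmax r <= Fmax q by have := Fmax_subgradient Qr Qq; nra.
have hE x : h r x = h q x by rewrite (h_affine q) D0 mulr0 addr0.
split; rewrite leNgt; apply/negP.
- by move=> /(h_left Qr Iwq); rewrite hE h_w// ltNge Frq.
- by move=> /(h_right Qr Iyq); rewrite hE h_y// ltNge Frq.
Qed.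

Lemma slope_strict q r : Q q -> Q r -> q < r -> slope r <= slope q ->
  w q = w r /\ y q = y r.
Proof.
move=> Qq Qr qr srq; apply: Fmax_subgradient_eq => //; apply/eqP.
rewrite eq_le Fmax_subgradient//=.
have := Fmax_subgradient Qr Qq; nra.
Qed.

(** As [D (w q) <= slope q], the value of [h] at [w q] grows no faster than [Fmax], so [w q] is not
    inside [(w r, y r)]; symmetrically, [y r] is not inside [(w q, y q)]. *)
Lemma increasing_maximizers q r :
  (forall u v, I u -> I v -> u < v -> D u <= l u v <= D v) ->
  Q q -> Q r -> q <= r -> w q <= w r /\ y q <= y r.
Proof.
move=> Dl Qq Qr; rewrite le_eqVlt => /predU1P[->//|qr].
have [Iwq Iyq wyq] := wy_in Qq; have [Iwr Iyr wyr] := wy_in Qr.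
have /andP[Dq1 Dq2] := Dl _ _ Iwq Iyq wyq.
have /andP[Dr1 Dr2] := Dl _ _ Iwr Iyr wyr.
have lo := Fmax_subgradient Qq Qr; have hi := Fmax_subgradient Qr Qq.
have [bad|good] := leP (y r) (w q).
  (* If [y r <= w q], then [slope r <= D (y r) <= D (w q) <= slope q], which forces equal slopes and
     a common maximizer. *)
  have Dyw : D (y r) <= D (w q).
    move: bad; rewrite le_eqVlt => /predU1P[->//|bad].
    by have /andP[] := Dl _ _ Iyr Iwq bad; exact: le_trans.
  have [wE yE] : w q = w r /\ y q = y r.
    by apply: slope_strict => //; rewrite /slope; lra.
  by move: bad wyr; rewrite wE; lra.
have h1 : h r (w q) <= Fmax r.
  by rewrite (h_affine q) h_w//; move: lo; rewrite /Fmax /slope; nra.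
have h2 : h q (y r) <= Fmax q.
  by rewrite (h_affine r) h_y//; move: hi; rewrite /Fmax /slope; nra.
split.
- by have [//|] := h_le_outside Qr h1; lra.
- by have [|//] := h_le_outside Qq h2; lra.
Qed.

(** [h q (w q) = h q (y q)] and the monotonicity of [E] give [D (y q) <= D (w q)]; by
    quasi-concavity [D] stays at or above [D (y q)] on the whole interval, and so does its mean
    [slope q]. Hence [y q] is not inside [(w r, y r)]. *)
Lemma decreasing_right_maximizer (E : R -> R) q r :
  (forall q x, h q x = q * D x + E x) -> (forall q, Q q -> 0 < q) ->
  (forall u v, I u -> I v -> u <= v -> E u <= E v) ->
  (forall u v z, I u -> I z -> u < v -> v < z -> D v < D u -> D z <= D v) ->
  (forall u v k, I u -> I v -> u < v ->
    (forall x, u <= x -> x <= v -> k <= D x) -> k <= l u v) ->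
  (forall u v k, I u -> I v -> u < v ->
    (forall x, u <= x -> x <= v -> D x <= k) -> l u v <= k) ->
  Q q -> Q r -> q <= r -> y r <= y q.
Proof.
move=> hE Qpos Eh Dqc lge lle Qq Qr; rewrite le_eqVlt => /predU1P[->//|qr].
have [Iwq Iyq wyq] := wy_in Qq; have [Iwr Iyr wyr] := wy_in Qr.
have lo := Fmax_subgradient Qq Qr; have hi := Fmax_subgradient Qr Qq.
have q0 := Qpos _ Qq.
have hwy : q * D (w q) + E (w q) = q * D (y q) + E (y q).
  by rewrite -!hE h_w// h_y.
have Ewy := Eh _ _ Iwq Iyq (ltW wyq).
have Dyw : D (y q) <= D (w q) by nra.
have Dyx x : w q <= x -> x <= y q -> D (y q) <= D x.
  rewrite le_eqVlt => /predU1P[<-//|wx].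
  rewrite le_eqVlt => /predU1P[->//|xy].
  rewrite leNgt; apply/negP => Dxy.
  have := Dqc _ _ _ Iwq Iyq wx xy (lt_le_trans Dxy Dyw).
  by rewrite leNgt Dxy.
have Dys : D (y q) <= slope q by exact: lge.
have h1 : h r (y q) <= Fmax r.
  by rewrite (h_affine q) h_y//; move: lo Dys; rewrite /Fmax /slope; nra.
have [bad|//] := h_le_outside Qr h1.
(* A point with [D x > D (y q)] lets quasi-concavity bound [D] by [D (y q)] to the right of [y q],
   where [(w r, y r)] lies. If [w q] is no such point, [E] agrees at both ends, and the strict
   excess of [h q] at the midpoint must come from [D]. *)
have [x [wx xy Dx]] : exists x, [/\ w q <= x, x < y q & D (y q) < D x].
  have [D_lt|D_ge] := ltP (D (y q)) (D (w q)); first by exists (w q).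
  pose x := (w q + y q) / 2.
  have [wx xy] : w q < x /\ x < y q by rewrite /x; split; lra.
  exists x; split => //; first exact: ltW.
  have Ix := state_space_mid Iwq Iyq (ltW wx) (ltW xy).
  have Exy := Eh _ _ Ix Iyq (ltW xy).
  have := h_inside Qq wx xy; rewrite /Fmax -(h_w Qq) !hE => hx.
  have DE : D (w q) = D (y q) by apply/eqP; rewrite eq_le D_ge Dyw.
  have EE : E (w q) = E (y q) by move: hwy; rewrite DE => /addrI.
  by rewrite -DE -(ltr_pM2l q0); move: hx Exy; rewrite EE; lra.
have Ix := state_space_mid Iwq Iyq wx (ltW xy).
have Dz z : y q <= z -> I z -> D z <= D (y q).
  rewrite le_eqVlt => /predU1P[<-//|yz] Iz.
  exact: (Dqc x).
have [_ yE] : w q = w r /\ y q = y r.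
  apply: slope_strict => //; apply: (le_trans _ Dys).
  apply: lle => // z wz zy; apply: Dz; first exact: le_trans wz.
  exact: (state_space_mid Iwr Iyr).
by move: bad wyr; rewrite yE; lra.
Qed.

End comparative_statics.

(** * Primitives and limits at the endpoints *)

Section interior_primitives.
Context {R : realType} (a : R) (b : \bar R).
Notation leb := (@lebesgue_measure R).
Implicit Types (f : R -> R) (x y l r u v : R).
Local Notation I := (state_space a b).

Definition interior_integrable f := forall u v, I u -> I v ->
  leb.-integrable `]u, v[ (EFin \o f).

Lemma continuous_interior_integrable f :
  (forall x, I x -> {for x, continuous f}) -> interior_integrable f.
Proof.
move=> fc u v Iu Iv.
have : leb.-integrable `[u, v] (EFin \o f).
  apply: continuous_compact_integrable; first exact: segment_compact.
  apply: continuous_in_subspaceT => x; rewrite inE/= in_itv/= => /andP[ux xv].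
  by apply: fc; exact: (state_space_mid Iu Iv).
by apply: integrableS => //; apply: subset_itv; rewrite bnd_simp.
Qed.

Lemma state_space_enclose x y : I x -> I y ->
  exists l r, [/\ I l, I r, l < x < r & l < y < r].
Proof.
move=> Ix Iy; have ax := state_space_gt Ix; have ay := state_space_gt Iy.
wlog xy : x y Ix Iy ax ay / x <= y.
  move=> H; have [xy|/ltW yx] := leP x y; first exact: H.
  by have [l [r [? ? ? ?]]] := H y x Iy Ix ay ax yx; exists l, r.
have [r Ir yr] := state_space_up Iy.
have al : a < (a + x) / 2 by lra.
exists ((a + x) / 2), r; split => //; last 2 first.
- by apply/andP; split; lra.
- by apply/andP; split; lra.
by apply: (state_space_down Ix) => //; lra.
Qed.

(** A base point [l] to the left of both [x0] and [x] removes the case distinction in the oriented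
    integral. *)
Lemma oriented_integral_near f x0 x : interior_integrable f -> I x0 -> I x ->
  exists l r, [/\ leb.-integrable `]l, r[ (EFin \o f), l < x < r &
    \forall y \near x, intoo f l y - intoo f l x0 = oriented_integral f x0 y].
Proof.
move=> fi Ix0 Ix.
have [l [r [Il Ir lxr lx0r]]] := state_space_enclose Ix Ix0.
exists l, r; split => //; first exact: fi.
apply: filterS (near_oo lxr) => y /andP[ly yr].
by rewrite (oriented_integralE (fi l r Il Ir)); lra.
Qed.

Lemma oriented_integral_continuous f x0 x : interior_integrable f -> I x0 -> I x ->
  {for x, continuous (oriented_integral f x0)}.
Proof.
move=> fi Ix0 Ix; have [l [r [flr lxr E]]] := oriented_integral_near fi Ix0 Ix.
rewrite /prop_for /continuous_at -[X in _ --> X](nbhs_singleton E).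
apply: cvg_trans; first exact: (near_eq_cvg E).
by apply: cvgB; [exact: intoo_continuous lxr|exact: cvg_cst].
Qed.

Lemma is_derive_oriented_integral f x0 x : (forall x, I x -> {for x, continuous f}) ->
  I x0 -> I x -> is_derive x 1 (oriented_integral f x0) (f x).
Proof.
move=> fc Ix0 Ix; have fi := continuous_interior_integrable fc.
have [l [r [flr lxr E]]] := oriented_integral_near fi Ix0 Ix.
apply: (near_eq_is_derive E).
rewrite -[f x]subr0; apply: is_deriveB.
exact: (is_derive_intoo flr lxr (fc x Ix)).
Qed.

Lemma oriented_integralB f x0 x y : interior_integrable f -> I x0 -> I x -> I y ->
  x <= y -> oriented_integral f x0 y - oriented_integral f x0 x = intoo f x y.
Proof.
move=> fi Ix0 Ix Iy xy.
have [l [r [Il Ir /andP[lx xr] /andP[lx0 x0r]]]] := state_space_enclose Ix Ix0.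
have [l' [r' [Il' Ir' /andP[ly yr'] _]]] := state_space_enclose Iy Ix0.
pose t := Num.max r r'.
have It : I t by rewrite /t /Num.max; case: ifP.
have [rt r't] : r <= t /\ r' <= t by rewrite !le_max !lexx orbT.
rewrite !(oriented_integralE (fi l t Il It)); try by apply/andP; split; lra.
rewrite (@intoo_split _ f l x y) ?(ltW lx)//; first by ring.
exact: fi.
Qed.

End interior_primitives.

(** * Behaviour at the left endpoint *)

Section left_endpoint.
Context {R : realType}.
Notation leb := (@lebesgue_measure R).
Implicit Types (f : R -> R) (l r x : R).

Lemma intoo_cvg_left f l r : l < r -> leb.-integrable `]l, r[ (EFin \o f) ->
  intoo f l x @[x --> l^'+] --> 0.
Proof.
move=> lr fi; pose v := (l + r) / 2.
have [lv vr] : l < v /\ v < r by rewrite /v; split; lra.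
have fv : leb.-integrable `[l, v] (EFin \o f).
  have fo : leb.-integrable `]l, v] (EFin \o f).
    by apply: integrableS fi => //; apply: subset_itv; rewrite bnd_simp.
  have /integrableP[fm foo] := fo; apply/integrableP; split.
    by move/measurable_EFinP: fm => /measurable_fun_itv_obnd_cbndP fm; apply/measurable_EFinP.
  rewrite -integral_itv_obnd_cbnd//; exact: measurableT_comp.
have /cvg_at_right_filter := parameterized_integral_cvg_left lv fv.
apply: cvg_trans; apply: near_eq_cvg; near=> x.
have [lx xv] : l < x /\ x < v.
  by split; near: x; [exact: nbhs_right_gt|exact: nbhs_right_lt].
rewrite /parameterized_integral /intoo.
rewrite -Rintegral_itv_obnd_cbnd; last first.
  by apply: integrableS fv => //; apply: subset_itv; rewrite bnd_simp// ltW.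
rewrite -Rintegral_itv_bndo_bndc//.
by apply: integrable_sub_oo fi _ _; lra.
Unshelve. all: by end_near. Qed.

(** The limit bounds [f] near [l], the extreme value theorem on the remaining segment [[v, r]]. *)
Lemma bounded_near_left f l r (k : R) : l < r ->
  (forall x, l < x <= r -> {for x, continuous f}) -> f x @[x --> l^'+] --> k ->
  exists B : R, forall x, l < x <= r -> `|f x| <= B.
Proof.
move=> lr fc fk.
have : \forall x \near l^'+, `|f x| < `|k| + 1.
  have fk' : `|f x| @[x --> l^'+] --> `|k| by exact: cvg_norm.

  by apply: (cvgr_lt _ fk'); lra.
move=> [d /= d0 dP].
pose v := Num.min (l + d / 2) r.
have [lv vd vr] : [/\ l < v, v < l + d & v <= r].
  split; first by rewrite lt_min; apply/andP; split; lra.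
    by rewrite gt_min; apply/orP; left; lra.
  by rewrite ge_min lexx orbT.
have fvr : {within `[v, r], continuous (fun x => `|f x|)}.
  apply: continuous_in_subspaceT => x; rewrite inE/= in_itv/= => /andP[vx xr].
  by apply: cvg_norm; apply: fc; lra.
have [t _ tP] := EVT_max vr fvr.
exists (Num.max (`|k| + 1) `|f t|) => x /andP[lx xr]; rewrite le_max; apply/orP.
have [xv|vx] := ltP x v; last by right; apply: tP; rewrite in_itv/= vx.
left; apply/ltW/dP => //=; rewrite ltr_distlC; lra.
Qed.

End left_endpoint.

(** * Scale and speed densities *)

Section diffusion_identities.
Context {R : realType} (a : R) (b : \bar R) (x0 : R) (mu sigma : R -> R).
Notation leb := (@lebesgue_measure R).
Implicit Types (f c : R -> R) (x y u v : R).
Local Notation I := (state_space a b).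
Hypothesis standing : standing_assumptions a b x0 mu sigma.

Let drift u := 2 * mu u / sigma u ^+ 2.
Let Phi := oriented_integral drift x0.
Local Notation s := (scale_density x0 mu sigma).
Local Notation m := (speed_density x0 mu sigma).
Local Notation M := (mass a m).

Let Ix0 : I x0. Proof. exact: sa_x0 standing. Qed.

Lemma drift_interior_integrable : interior_integrable a b drift.
Proof.
move=> u v Iu Iv; have := sa_drift_integrable standing Iu Iv.
by apply: integrableS => //; apply: subset_itv; rewrite bnd_simp.
Qed.

Lemma scale_densityE x : s x = (expR (Phi x))^-1.
Proof. by rewrite /scale_density expRN. Qed.

Lemma scale_density_gt0 x : 0 < s x.
Proof. exact: expR_gt0. Qed.

Lemma scale_density_continuous x : I x -> {for x, continuous s}.
Proof.
move=> Ix; apply: continuous_comp; last exact: continuous_expR.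
apply: cvgN; exact: (oriented_integral_continuous drift_interior_integrable Ix0 Ix).
Qed.

Lemma speed_density_gt0 x : I x -> 0 < m x.
Proof.
move=> Ix; rewrite divr_gt0// mulr_gt0 ?scale_density_gt0//.
exact: (sa_sigma_pos standing).
Qed.

(** Measurability comes from integrability on segments inside the state space, so []a, x[] is
    exhausted by intervals starting at [a + 1/(k+1)]. *)
Lemma speed_density_measurable x : I x -> measurable_fun `]a, x[ m.
Proof.
move=> Ix; rewrite itv_open_bnd_bigcup.
apply/measurable_fun_bigcup => // k.
have [kx|xk] := ltP (a + k.+1%:R^-1) x; last first.
  by rewrite set_itv_ge ?bnd_simp -?leNgt//; exact: measurable_fun_set0.
have Ik : I (a + k.+1%:R^-1).
  by apply: (state_space_down Ix) (ltW kx); rewrite ltrDl invr_gt0.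
have /measurable_int/measurable_EFinP := sa_speed_integrable standing Ik Ix.
by apply: measurable_funS => //; apply: subset_itv; rewrite bnd_simp.
Qed.

Lemma speed_density_integrable x : I x -> leb.-integrable `]a, x[ (EFin \o m).
Proof.
move=> Ix; apply/integrableP; split.
  by apply/measurable_EFinP; exact: speed_density_measurable.
have := sa_left_speed_finite standing Ix.
rewrite /speed_measure ooint_itv; congr (_ < _)%E.
apply: eq_integral => u; rewrite inE/= in_itv/= => /andP[au ux].
have Iu := state_space_down Ix au (ltW ux).
by rewrite gtr0_norm// speed_density_gt0.
Qed.

Lemma left_speedE x : left_speed a x0 mu sigma x = M x.
Proof. by rewrite /left_speed /speed_measure ooint_itv. Qed.

Lemma weightable_bounded f : (forall x, I x -> {for x, continuous f}) ->
  (forall x, I x -> exists B : R, forall u, a < u < x -> `|f u| <= B) ->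
  weightable a b m f.
Proof.
move=> fc fB x Ix; have [B fBx] := fB x Ix.
have : leb.-integrable `]a, x[ (EFin \o (fun u => m u * f u)).
  apply: integrable_mul_bounded fBx; first exact: speed_density_integrable.
  apply: continuous_measurable_oo => u /andP[au ux].
  by apply/fc/(state_space_down Ix au)/ltW.
by apply: eq_integrable => // u _ /=; rewrite mulrC.
Qed.

Lemma mu_continuous x : I x -> {for x, continuous mu}.
Proof. by move=> Ix; apply: (sa_mu_continuous standing); rewrite inE. Qed.

Lemma weightable_mu : weightable a b m mu.
Proof.
apply: weightable_bounded; first exact: mu_continuous.
move=> x Ix; have [k muk] := sa_mu_left standing.
have [|B HB] := bounded_near_left (state_space_gt Ix) _ muk.
  by move=> u /andP[au ux]; apply/mu_continuous/(state_space_down Ix).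
by exists B => u /andP[au ux]; apply: HB; rewrite au ltW.
Qed.

Lemma weightable_increasing c : (forall x, I x -> {for x, continuous c}) ->
  (forall x, I x -> 0 <= c x) -> increasing_on I c -> weightable a b m c.
Proof.
move=> cc c0 ci; apply: weightable_bounded => // x Ix.
exists (c x) => u /andP[au ux]; have Iu := state_space_down Ix au (ltW ux).
by rewrite ger0_norm ?c0// ci ?inE// ltW.
Qed.

(** [expR (Phi x)] is [1 / s(x)], and the integrand [drift / s] delivered by [expR_primitive] equals
    [mu m]. *)
Lemma exp_increment u x : I u -> I x -> u <= x ->
  expR (Phi x) - expR (Phi u) = wint a m mu x - wint a m mu u.
Proof.
move=> Iu Ix ux; have au := state_space_gt Iu.
have [l [r [Il Ir /andP[lu _] /andP[_ xr]]]] := state_space_enclose Iu Ix.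
rewrite (expR_primitive (drift_interior_integrable Il Ir) _ lu ux xr); last first.
  move=> y z ly yz zr; apply: (oriented_integralB drift_interior_integrable) => //.
    by apply: (state_space_mid Il Ir); lra.
  by apply: (state_space_mid Il Ir); lra.
rewrite /wint (@intoo_split _ _ a u x (ltW au) ux (weightable_mu Ix)) addrC addKr.
apply: eq_intoo => y /andP[uy yx].
have Iy : I y by apply: (state_space_mid Iu Ix); exact: ltW.
have sy := sa_sigma_pos standing Iy; have ey := expR_gt0 (Phi y).
rewrite /speed_density scale_densityE /drift; field.
have sy0 : sigma y != 0 by apply: contraTneq sy => ->; rewrite expr0n ltxx.
by rewrite sy0 gt_eqF.
Qed.

(* [1/s(x) = 1/s(u) + int_u^x mu dM]; as [u -> a] the left-over constant
   [1/s(a+)] vanishes because [S(a, x] = +oo]. *)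
Lemma wint_mu x : I x -> wint a m mu x = (s x)^-1.
Proof.
move=> Ix; have ax := state_space_gt Ix.
pose lam := expR (Phi x) - wint a m mu x.
have lamE u : I u -> u <= x -> expR (Phi u) = lam + wint a m mu u.
  move=> Iu ux; have := exp_increment Iu Ix ux; rewrite /lam.
  by move: (expR _) (expR _) (wint _ _ _ x) (wint _ _ _ u) => *; lra.
have lim : expR (Phi u) @[u --> a^'+] --> lam.
  rewrite -[X in _ --> X]addr0.
  apply: cvg_trans; last first.
    exact: (cvgD (cvg_cst lam) (intoo_cvg_left ax (weightable_mu Ix))).
  apply: near_eq_cvg; near=> u.
  have [au ux] : a < u /\ u < x.
    by split; near: u; [exact: nbhs_right_gt|exact: nbhs_right_lt].
  rewrite lamE//; last exact: ltW.
  by apply: (state_space_down Ix) => //; exact: ltW.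
suff lam0 : lam = 0 by rewrite scale_densityE invrK; rewrite /lam in lam0; lra.
apply/eqP; rewrite eq_le; apply/andP; split; last first.
  by apply: (cvgr_to_ge lim); near=> u; exact: expR_ge0.
rewrite leNgt; apply/negP => lam_gt0.
(* Were [lam] positive, [s] would stay below [2 / lam] close to [a], and the scale measure there
   would be finite. *)
have : \forall u \near a^'+, lam / 2 < expR (Phi u) by apply: (cvgr_gt _ lim); lra.
move=> [d /= d0 dP].
pose y := Num.min x (a + d / 2).
have [ay yx yd] : [/\ a < y, y <= x & y < a + d].
  rewrite lt_min !ge_min lexx gt_min; split => //; first by apply/andP; split; lra.
  by apply/orP; right; lra.
have Iy := state_space_down Ix ay yx.
have := sa_left_non_attracting standing Iy; apply/eqP.
rewrite lt_eqF// /scale_measure ooint_itv.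
apply: (@le_lt_trans _ _ (\int[leb]_(u in `]a, y[) (2 / lam)%:E)%E); last first.
  by rewrite integral_cst//= lebesgue_measure_itv/= lte_fin ay -EFinD -EFinM ltry.
apply: ge0_le_integral => //.
- by move=> u _; rewrite lee_fin ltW// scale_density_gt0.
- apply/measurable_EFinP; apply: continuous_measurable_oo => u /andP[au uy].
  by apply/scale_density_continuous/(state_space_down Iy au)/ltW.
- move=> u /=; rewrite in_itv/= => /andP[au uy]; rewrite lee_fin scale_densityE.
  have /ltW h : lam / 2 < expR (Phi u).
    by apply: dP => //=; rewrite ltr_distlC; apply/andP; split; lra.
  rewrite -[2 / lam]invrK invf_div lef_pV2 ?posrE ?expR_gt0//; lra.
Unshelve. all: by end_near. Qed.

Lemma speed_mass_gt0 x : I x -> 0 < M x.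
Proof. exact: (mass_gt0 speed_density_gt0 speed_density_integrable). Qed.

Lemma mass_continuous x : I x -> {for x, continuous M}.
Proof.
move=> Ix; have [y Iy xy] := state_space_up Ix.
apply: (intoo_continuous (speed_density_integrable Iy)).
by rewrite xy (state_space_gt Ix).
Qed.

Lemma wint_continuous f x : weightable a b m f -> I x ->
  {for x, continuous (wint a m f)}.
Proof.
move=> fw Ix; have [y Iy xy] := state_space_up Ix.
apply: (intoo_continuous (fw y Iy)).
by rewrite xy (state_space_gt Ix).
Qed.

Lemma is_derive_xi x : I x -> is_derive x 1 (xi a x0 mu sigma) (M x * s x).
Proof.
move=> Ix; rewrite -left_speedE.
apply: (is_derive_oriented_integral (b := b)
  (f := fun v => left_speed a x0 mu sigma v * s v) _ Ix0 Ix) => {}x {}Ix.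
rewrite (_ : left_speed a x0 mu sigma = M); last by apply/funext => v; exact: left_speedE.
by apply: cvgM; [exact: mass_continuous|exact: scale_density_continuous].
Qed.

Lemma is_derive_gfun c x : weightable a b m c -> I x ->
  is_derive x 1 (gfun a x0 mu sigma c) (wint a m c x * s x).
Proof.
move=> cw Ix.
have E v : \int[lebesgue_measure]_(u in ooint a%:E v%:E) (c u * m u) = wint a m c v.
  by rewrite ooint_itv.
rewrite -E.
apply: (is_derive_oriented_integral (b := b)
  (f := fun v => \int[lebesgue_measure]_(u in ooint a%:E v%:E) (c u * m u) * s v)
  _ Ix0 Ix) => {}x {}Ix.
rewrite (_ : (fun v => \int[lebesgue_measure]_(u in ooint a%:E v%:E) (c u * m u) * s v)
  = (fun v => wint a m c v * s v)); last by apply/funext => v; rewrite E.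
by apply: cvgM; [exact: wint_continuous|exact: scale_density_continuous].
Qed.

End diffusion_identities.

(** * Maximizing the ratio *)

Lemma is_derive_continuous {R : realType} (f : R -> R) (x df : R) :
  is_derive x 1 f df -> {for x, continuous f}.
Proof. by move=> [/derivable1_diffP/differentiable_continuous]. Qed.

Section increments.
Context {R : realType} (a : R) (b : \bar R).
Local Notation I := (state_space a b).
Implicit Types (u v k : R).
Variables (X G X' B : R -> R).
Hypothesis X_derive : forall x, I x -> is_derive x 1 X (X' x).
Hypothesis X'_gt0 : forall x, I x -> 0 < X' x.
Hypothesis G_derive : forall x, I x -> is_derive x 1 G (B x * X' x).

Lemma MVT_state_space (f df : R -> R) u v : (forall x, I x -> is_derive x 1 f (df x)) ->
  I u -> I v -> u < v ->
  exists c : R, [/\ u < c, c < v, I c & f v - f u = df c * (v - u)].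
Proof.
move=> fd Iu Iv uv.
have Imid x : u <= x -> x <= v -> I x by exact: state_space_mid.
have [||c] := @MVT R f df u v uv.
- by move=> x; rewrite in_itv/= => /andP[ux xv]; apply/fd/Imid; exact: ltW.
- apply: derivable_within_continuous => x; rewrite in_itv/= => /andP[ux xv].
  by have [] := fd x (Imid x ux xv).
rewrite in_itv/= => /andP[uc cv] E; exists c; split => //.
by apply: Imid; exact: ltW.
Qed.

Lemma increment_gt0 u v : I u -> I v -> u < v -> 0 < X v - X u.
Proof.
move=> Iu Iv uv; have [c [_ _ Ic ->]] := MVT_state_space X_derive Iu Iv uv.
by rewrite mulr_gt0 ?X'_gt0 ?subr_gt0.
Qed.

Lemma is_derive_sub_scale k x : I x ->
  is_derive x 1 (fun x => G x - k * X x) ((B x - k) * X' x).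
Proof.
move=> Ix; have Gd := G_derive Ix; have Xd := X_derive Ix.
rewrite mulrBl; exact: is_deriveB.
Qed.

(** One half of Cauchy's mean value theorem, as [B] is the ratio of the derivatives of [G] and [X];
    the mean value theorem is applied to [G - k X]. *)
Lemma increment_ratio_ge u v k : I u -> I v -> u < v ->
  (forall x, u <= x -> x <= v -> k <= B x) -> k <= (G v - G u) / (X v - X u).
Proof.
move=> Iu Iv uv kB; rewrite ler_pdivlMr ?increment_gt0// -subr_ge0.
have [c [uc cv Ic]] := MVT_state_space (is_derive_sub_scale k) Iu Iv uv.
have := kB c (ltW uc) (ltW cv); have := X'_gt0 Ic => Xc Bc E.
have : 0 <= (B c - k) * X' c * (v - u).
  by rewrite !mulr_ge0// ?subr_ge0// ltW.
by rewrite -E; lra.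
Qed.

Lemma increment_ratio_le u v k : I u -> I v -> u < v ->
  (forall x, u <= x -> x <= v -> B x <= k) -> (G v - G u) / (X v - X u) <= k.
Proof.
move=> Iu Iv uv kB; rewrite ler_pdivrMr ?increment_gt0// -subr_le0.
have [c [uc cv Ic]] := MVT_state_space (is_derive_sub_scale k) Iu Iv uv.
have := kB c (ltW uc) (ltW cv); have := X'_gt0 Ic => Xc Bc E.
have : 0 <= (k - B c) * X' c * (v - u).
  by rewrite !mulr_ge0// ?subr_ge0// ltW.
by move: E; lra.
Qed.

End increments.

(* [X], [G], [A] and [C] stand for [xi], [g] and the averages of [mu] and [c]. *)
Section ratio_problem.
Context {R : realType} (a : R) (b : \bar R).
Implicit Types (th : params R) (q r u v x z : R).
Local Notation I := (state_space a b).
Variables (X G X' A C : R -> R).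
Hypothesis X_derive : forall x, I x -> is_derive x 1 X (X' x).
Hypothesis X'_gt0 : forall x, I x -> 0 < X' x.
Hypothesis A_X' : forall x, I x -> A x * X' x = 1.
Hypothesis G_derive : forall x, I x -> is_derive x 1 G (C x * X' x).

Definition reward_ratio th u v : R :=
  (price th * (v - u) - fixed_cost th + weight th * (G v - G u)) / (X v - X u).

Definition average_revenue th x : R := price th * A x + weight th * C x.

(** In this form the term [v - u] is treated exactly as [G v - G u], with [A] in place of [C]. *)
Lemma id_derive x : I x -> is_derive x 1 (@id R) (A x * X' x).
Proof. by move=> Ix; rewrite A_X'//; exact: is_derive_id. Qed.

Lemma X_increment_gt0 u v : I u -> I v -> u < v -> 0 < X v - X u.
Proof. exact: (increment_gt0 X_derive X'_gt0). Qed.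

(** Fixing [k] at the optimal ratio linearizes the problem: an increment of [psi] is at most the
    fixed cost, with equality at [(u, v)]. So [v] maximizes [psi] to the right of [u], [u] minimizes
    it to the left of [v], and [psi' = (average_revenue - k) X'] vanishes at both. *)
Lemma maximizer_first_order th u v : I u -> I v -> u < v ->
  (forall u' v', I u' -> I v' -> u' < v' -> reward_ratio th u' v' <= reward_ratio th u v) ->
  average_revenue th u = reward_ratio th u v /\ average_revenue th v = reward_ratio th u v.
Proof.
move=> Iu Iv uv ratio_max; set k := reward_ratio th u v.
pose psi x := price th * x + weight th * G x - k * X x.
have psid x : I x -> is_derive x 1 psi ((average_revenue th x - k) * X' x).
  move=> Ix; have gd := G_derive Ix; have xd := X_derive Ix.
  have pd : is_derive x 1 (fun x => price th * x) (price th * (A x * X' x)).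
    exact: (is_deriveZ (price th) (id_derive Ix)).
  have wd : is_derive x 1 (fun x => weight th * G x) (weight th * (C x * X' x)).
    exact: (is_deriveZ (weight th) gd).
  have kd : is_derive x 1 (fun x => k * X x) (k * X' x) by exact: (is_deriveZ k xd).
  rewrite /average_revenue mulrBl mulrDl -[_ * A x * _]mulrA -[_ * C x * _]mulrA.
  exact: (is_deriveB (is_deriveD pd wd) kd).
have psi_max u' v' : I u' -> I v' -> u' < v' -> psi v' - psi u' <= psi v - psi u.
  move=> Iu' Iv' uv'.
  have := ratio_max u' v' Iu' Iv' uv'; rewrite -/k /reward_ratio ler_pdivrMr ?X_increment_gt0//.
  have : k * (X v - X u) = price th * (v - u) - fixed_cost th + weight th * (G v - G u).
    by rewrite /k divfK// gt_eqF// X_increment_gt0.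
  rewrite /psi; lra.
have zero x : I x -> is_derive x 1 psi 0 -> average_revenue th x = k.
  move=> Ix d0; have d1 := psid x Ix.
  have : (average_revenue th x - k) * X' x = 0.
    by rewrite -(@derive_val _ _ _ _ _ _ _ d1) (@derive_val _ _ _ _ _ _ _ d0).
  move=> /eqP; rewrite mulf_eq0 (gt_eqF (X'_gt0 Ix)) orbF subr_eq0.
  by move=> /eqP.
have au := state_space_gt Iu.
pose l := (a + u) / 2; have [al lu] : a < l /\ l < u by rewrite /l; split; lra.
have Il := state_space_down Iu al (ltW lu).
have [r Ir vr] := state_space_up Iv.
clearbody psi.
split; [apply: (zero u Iu)|apply: (zero v Iv)].
- have opp_max : is_derive u 1 (fun x => - psi x) 0.
    apply: (@derive1_at_max _ _ l v).
    + by rewrite ltW// (lt_trans lu).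
    + move=> t; rewrite in_itv/= => /andP[lt tv].
      have It : I t by apply: (state_space_mid Il Iv); exact: ltW.
      by apply: derivableN; have [] := psid t It.
    + by rewrite in_itv/= lu uv.
    + move=> t; rewrite in_itv/= => /andP[lt tv].
      have It : I t by apply: (state_space_mid Il Iv); exact: ltW.
      have := psi_max t v It Iv tv; lra.
  have := is_deriveN opp_max.
  rewrite oppr0 (_ : - (fun x => - psi x) = psi)//.
  by apply/funext => t; rewrite /GRing.opp/= opprK.
- apply: (@derive1_at_max _ _ u r).
  + by rewrite ltW// (lt_trans uv).
  + move=> t; rewrite in_itv/= => /andP[ut tr].
    have It : I t by apply: (state_space_mid Iu Ir); exact: ltW.
    by have [] := psid t It.
  + by rewrite in_itv/= uv vr.
  + move=> t; rewrite in_itv/= => /andP[ut tr].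
    have It : I t by apply: (state_space_mid Iu Ir); exact: ltW.
    have := psi_max u t Iu It ut; lra.
Qed.

(** The partial derivative of [reward_ratio] in the chosen parameter, in the role of [l];
    [marginal_average] plays the role of [D]. *)
Definition parameter_slope (k : parameter_name) u v : R :=
  match k with
  | Par_p => (v - u) / (X v - X u)
  | Par_K => - (X v - X u)^-1
  | Par_gamma => (G v - G u) / (X v - X u)
  end.

Definition marginal_average (k : parameter_name) x : R :=
  match k with Par_p => A x | Par_K => 0 | Par_gamma => C x end.

Lemma reward_ratio_affine k th q r u v :
  reward_ratio (with_parameter k th r) u v =
  reward_ratio (with_parameter k th q) u v + (r - q) * parameter_slope k u v.
Proof. by rewrite /reward_ratio /parameter_slope; case: k => /=; set d := (_ - _)^-1; ring. Qed.

Lemma average_revenue_affine k th q r x :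
  average_revenue (with_parameter k th r) x =
  average_revenue (with_parameter k th q) x + (r - q) * marginal_average k x.
Proof. by rewrite /average_revenue; case: k => /=; ring. Qed.

Lemma parameter_slope_continuous k (w y : R -> R) q :
  {for q, continuous w} -> {for q, continuous y} ->
  I (w q) -> I (y q) -> w q < y q ->
  {for q, continuous (fun q => parameter_slope k (w q) (y q))}.
Proof.
move=> wc yc Iw Iy wy.
have comp (f z : R -> R) : {for z q, continuous f} -> {for q, continuous z} ->
    f (z r) @[r --> q] --> (f (z q) : R) by move=> fc zc; exact: continuous_comp.
have Xc x : I x -> {for x, continuous X}.
  by move=> Ix; exact: is_derive_continuous (X_derive Ix).
have Gc x : I x -> {for x, continuous G}.
  by move=> Ix; exact: is_derive_continuous (G_derive Ix).
have dX := cvgB (comp _ _ (Xc _ Iy) yc) (comp _ _ (Xc _ Iw) wc).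
have dG := cvgB (comp _ _ (Gc _ Iy) yc) (comp _ _ (Gc _ Iw) wc).
have dV : (X (y r) - X (w r))^-1 @[r --> q] --> (X (y q) - X (w q))^-1.
  by apply: cvgV; [rewrite gt_eqF// X_increment_gt0|exact: dX].
case: k; rewrite /prop_for /continuous_at.
- by apply: cvgM; [exact: (cvgB yc wc)|exact: dV].
- by apply: cvgN; exact: dV.
- by apply: cvgM; [exact: dG|exact: dV].
Qed.

(** * Comparative statics for the price, the fixed cost and the weight *)

Section monotonicity.
Variables (th : params R) (k : parameter_name) (Q : set R) (w y : R -> R).
Let F q u v := reward_ratio (with_parameter k th q) u v.
Let h q x := average_revenue (with_parameter k th q) x.
Let Fstar q := F q (w q) (y q).
Let slope q := parameter_slope k (w q) (y q).
Hypothesis gamma_gt0 : 0 < weight th.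
Hypothesis Q_open : open Q.
Hypothesis Q_pos : forall q, Q q -> 0 < q.
Hypothesis wy_in : forall q, Q q -> [/\ I (w q), I (y q) & w q < y q].
Hypothesis wy_max : forall q, Q q -> forall u v, I u -> I v -> u < v ->
  F q u v <= F q (w q) (y q).
Hypothesis wy_unique : forall q, Q q -> forall u v, I u -> I v -> u < v ->
  F q u v = F q (w q) (y q) -> u = w q /\ v = y q.
Hypothesis h_quasiconcave : forall q, Q q -> forall u v z, I u -> I z ->
  u < v -> v < z -> h q v <= h q u -> h q z < h q v.
Hypothesis A_quasiconcave : forall u v z, I u -> I z ->
  u < v -> v < z -> A v < A u -> A z <= A v.
Hypothesis C_ge0 : forall x, I x -> 0 <= C x.
Hypothesis C_ndecr : forall u v, I u -> I v -> u <= v -> C u <= C v.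

Let F_affine := reward_ratio_affine k th.
Let h_affine := average_revenue_affine k th.

Let h_w q : Q q -> h q (w q) = F q (w q) (y q).
Proof.
move=> Qq; have [Iw Iy wy] := wy_in Qq.
by have [] := maximizer_first_order Iw Iy wy (wy_max Qq).
Qed.

Let h_y q : Q q -> h q (y q) = F q (w q) (y q).
Proof.
move=> Qq; have [Iw Iy wy] := wy_in Qq.
by have [] := maximizer_first_order Iw Iy wy (wy_max Qq).
Qed.

Lemma Fstar_derive q : Q q -> is_derive q 1 Fstar (slope q).
Proof.
move=> Qq; apply: (is_derive_Fmax Q_open F_affine wy_in wy_max Qq).
have [Iw Iy wy] := wy_in Qq.
apply: parameter_slope_continuous => //.
- exact: (w_continuous Q_open F_affine h_affine wy_in wy_max h_w h_y h_quasiconcave).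
- exact: (y_continuous Q_open F_affine h_affine wy_in wy_max h_w h_y h_quasiconcave).
Qed.

Lemma slope_increasing : increasing_on Q slope.
Proof.
move=> q r; rewrite !inE => Qq Qr qr.
exact: (slope_ndecr F_affine wy_in wy_max Qq Qr qr).
Qed.

Lemma derive1_Fstar_increasing : increasing_on Q (derive1 Fstar).
Proof.
have dF q : Q q -> derive1 Fstar q = slope q.
  by move=> Qq; rewrite derive1E; apply: derive_val; exact: Fstar_derive.
by move=> q r Qq Qr qr; rewrite !dF; [exact: slope_increasing|exact: set_mem..].
Qed.

Lemma Fstar_ndecr q r : Q q -> Q r -> q <= r -> 0 <= slope q -> Fstar q <= Fstar r.
Proof.
move=> Qq Qr qr.
have : Fstar q + (r - q) * slope q <= Fstar r.
  exact: (Fmax_subgradient F_affine wy_in wy_max Qq Qr).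
nra.
Qed.

Lemma Fstar_nincr q r : Q q -> Q r -> q <= r -> slope r <= 0 -> Fstar r <= Fstar q.
Proof.
move=> Qq Qr qr.
have : Fstar r + (q - r) * slope r <= Fstar q.
  exact: (Fmax_subgradient F_affine wy_in wy_max Qr Qq).
nra.
Qed.

Lemma statics_price : k = Par_p ->
  increasing_on Q Fstar /\ decreasing_on Q y.
Proof.
move=> kE; split.
  move=> q r; rewrite !inE => Qq Qr qr; have [Iw Iy wy] := wy_in Qq.
  apply: Fstar_ndecr => //; rewrite /slope kE /=.
  by apply: divr_ge0; apply: ltW; [rewrite subr_gt0|exact: X_increment_gt0].
move=> r q; rewrite !inE => Qr Qq qr.
apply: (decreasing_right_maximizer F_affine h_affine wy_in wy_max wy_unique
  h_w h_y h_quasiconcave (E := fun x => weight th * C x) _ Q_pos _ _ _ _ Qq Qr qr).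
- by move=> p x; rewrite /h /average_revenue kE.
- by move=> u v Iu Iv uv; rewrite ler_wpM2l ?(ltW gamma_gt0)// C_ndecr.
- by rewrite kE /=; exact: A_quasiconcave.
- rewrite kE /= => u v e; exact: (increment_ratio_ge X_derive X'_gt0 id_derive).
- rewrite kE /= => u v e; exact: (increment_ratio_le X_derive X'_gt0 id_derive).
Qed.

Lemma statics_fixed_cost : k = Par_K ->
  [/\ decreasing_on Q Fstar, decreasing_on Q w & increasing_on Q y].
Proof.
move=> kE.
have slope_le0 u v : I u -> I v -> u < v -> parameter_slope k u v <= 0.
  by move=> Iu Iv uv; rewrite kE /= oppr_le0 invr_ge0 ltW// X_increment_gt0.
have nested q r : Q q -> Q r -> q <= r -> w r <= w q /\ y q <= y r.
  apply: (nested_maximizers F_affine h_affine wy_in wy_max h_w h_y h_quasiconcave) => //.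
  by rewrite kE.
split.
- move=> r q; rewrite !inE => Qr Qq qr; have [Iw Iy wy] := wy_in Qr.
  by apply: Fstar_nincr => //; exact: slope_le0.
- by move=> r q; rewrite !inE => Qr Qq qr; have [] := nested q r Qq Qr qr.
- by move=> q r; rewrite !inE => Qq Qr qr; have [] := nested q r Qq Qr qr.
Qed.

Lemma statics_weight : k = Par_gamma ->
  [/\ increasing_on Q Fstar, increasing_on Q w & increasing_on Q y].
Proof.
move=> kE.
(* The ratio of increments is a mean of the nondecreasing [C] over [[u, v]]. *)
have slope_bounds u v : I u -> I v -> u < v ->
    marginal_average k u <= parameter_slope k u v <= marginal_average k v.
  move=> Iu Iv uv; rewrite kE /=; apply/andP; split.
    apply: (increment_ratio_ge X_derive X'_gt0 G_derive) => // x ux xv.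
    by apply: C_ndecr => //; exact: (state_space_mid Iu Iv).
  apply: (increment_ratio_le X_derive X'_gt0 G_derive) => // x ux xv.
  by apply: C_ndecr => //; exact: (state_space_mid Iu Iv).
have shift q r : Q q -> Q r -> q <= r -> w q <= w r /\ y q <= y r.
  exact: (increasing_maximizers F_affine h_affine wy_in wy_max wy_unique h_w h_y
    h_quasiconcave).
split.
- move=> q r; rewrite !inE => Qq Qr qr; have [Iw Iy wy] := wy_in Qq.
  apply: Fstar_ndecr => //; have /andP[+ _] := slope_bounds _ _ Iw Iy wy.
  by apply: le_trans; rewrite kE; exact: C_ge0.
- by move=> q r; rewrite !inE => Qq Qr qr; have [] := shift q r Qq Qr qr.
- by move=> q r; rewrite !inE => Qq Qr qr; have [] := shift q r Qq Qr qr.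
Qed.

End monotonicity.
End ratio_problem.

(** * The diffusion as an instance of the ratio problem *)

Section diffusion_ratio.
Context {R : realType} (a : R) (b : \bar R) (x0 : R) (mu sigma c : R -> R).
Implicit Types (u v x : R).
Local Notation I := (state_space a b).
Local Notation s := (scale_density x0 mu sigma).
Local Notation m := (speed_density x0 mu sigma).
Local Notation M := (mass a m).
Local Notation avg := (avg a m).
Hypothesis standing : standing_assumptions a b x0 mu sigma.

(** The extension changes [f] at [a] only, and [x] has a neighbourhood that avoids [a]. *)
Lemma is_derive_extend_at (f : R -> R) x (df : R) : I x ->
  is_derive x 1 f df -> is_derive x 1 (extend_at a f) df.
Proof.
move=> Ix; apply: near_eq_is_derive.
have [y Iy xy] := state_space_up Ix.
have : a < x < y by rewrite xy (state_space_gt Ix).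
by move=> /near_oo; apply: filterS => z /andP[az _]; rewrite /extend_at gt_eqF.
Qed.

Lemma xi'_gt0 x : I x -> 0 < M x * s x.
Proof.
by move=> Ix; rewrite mulr_gt0 ?(scale_density_gt0 x0)// (speed_mass_gt0 standing).
Qed.

Lemma avg_xi' f x : I x -> avg f x * (M x * s x) = wint a m f x * s x.
Proof.
by move=> Ix; rewrite mulrA -(avgM (speed_density_gt0 standing)
  (speed_density_integrable standing)).
Qed.

Lemma avg_mu_xi' x : I x -> avg mu x * (M x * s x) = 1.
Proof.
move=> Ix; rewrite avg_xi'// (wint_mu standing)//.
by rewrite mulVf// gt_eqF// scale_density_gt0.
Qed.

Lemma is_derive_extended_xi x : I x ->
  is_derive x 1 (extend_at a (xi a x0 mu sigma)) (M x * s x).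
Proof. by move=> Ix; apply: is_derive_extend_at => //; exact: (is_derive_xi standing). Qed.

Lemma is_derive_extended_gfun x : weightable a b m c -> I x ->
  is_derive x 1 (extend_at a (gfun a x0 mu sigma c)) (avg c x * (M x * s x)).
Proof.
move=> cw Ix; rewrite avg_xi'//.
by apply: is_derive_extend_at => //; exact: (is_derive_gfun standing).
Qed.

Lemma ordered_pairs_interior u v : ordered_pairs a b x0 mu sigma (u, v) ->
  a < u -> [/\ I u, I v & u < v].
Proof.
move=> [/= [Iu|[_ ->]] [Iv|[_ ->]] uv] au //; try by rewrite ltxx in au.
by have := lt_trans au uv; rewrite ltxx.
Qed.

Lemma interior_ordered_pairs u v : I u -> I v -> u < v ->
  ordered_pairs a b x0 mu sigma (u, v).
Proof. by move=> Iu Iv uv; split => //; left. Qed.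

End diffusion_ratio.

Theorem proposition6p3 (R : realType) (a : R) (b : \bar R) (x0 : R)
    (mu sigma c : R -> R) (ca cb : R)
    (th : params R) (k : parameter_name) (Q : set R) (w y : R -> R)
    (standing : standing_assumptions a b x0 mu sigma)
    (p_gt0 : 0 < price th) (K_gt0 : 0 < fixed_cost th) (gamma_gt0 : 0 < weight th)
    (Q_open : open Q) (Q_itv : is_interval Q) (Q_pos : Q `<=` `]0, +oo[)
    (c_ge0 : forall x, state_space a b x -> 0 <= c x)
    (c_cont : {in state_space a b, continuous c})
    (c_incr : increasing_on (state_space a b) c)
    (c_left : c x @[x --> a^'+] --> ca)
    (c_right : c x @[x --> to_right_end b] --> cb)
    (ca_ge0 : 0 <= ca) (ca_lt_cb : ca < cb)
    (g_C2 : C2_on (state_space a b) (gfun a x0 mu sigma c))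
    (r_shape : forall q, Q q ->
      let r := revenue_rate mu c (with_parameter k th q) in
      exists xhat xtilde : R,
        [/\ state_space a b xhat, state_space a b xtilde & xhat <= xtilde] /\
        [/\ strictly_increasing_on (ooint a%:E xhat%:E) r,
            constant_on (ooint xhat%:E xtilde%:E) r
          & strictly_decreasing_on (ooint xtilde%:E b) r])
    (mu_shape : exists xmu : R,
        [/\ state_space a b xmu,
            strictly_increasing_on (ooint a%:E xmu%:E) mu
          & concave_on (ooint xmu%:E b) mu])
    (F_large : forall q, Q q -> exists wt yt : R,
        ordered_pairs a b x0 mu sigma (wt, yt) /\
        weight (with_parameter k th q) * cbar a b x0 mu sigma c cb
          < Fobj a x0 mu sigma c (with_parameter k th q) wt yt)
    (wy_max : forall q, Q q ->
        is_unique_maximizer a b x0 mu sigma c (with_parameter k th q) (w q) (y q))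
    (w_gt_a : forall q, Q q -> a < w q) :
  let Fstar := fun q => Fobj a x0 mu sigma c (with_parameter k th q) (w q) (y q) in
  let zstar := fun q => zratio a x0 mu sigma (w q) (y q) in
  (forall q, Q q -> derivable Fstar q 1) /\
  match k with
  | Par_p =>
      [/\ increasing_on Q Fstar, increasing_on Q (derive1 Fstar),
          decreasing_on Q y & increasing_on Q zstar]
  | Par_K =>
      [/\ decreasing_on Q Fstar, increasing_on Q (derive1 Fstar),
          decreasing_on Q w & increasing_on Q y]
  | Par_gamma =>
      [/\ increasing_on Q Fstar, increasing_on Q (derive1 Fstar),
          increasing_on Q w & increasing_on Q y]
  end.
Proof.
move=> Fstar zstar.
set X := extend_at a (xi a x0 mu sigma).
set G := extend_at a (gfun a x0 mu sigma c).
set m := speed_density x0 mu sigma.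
set X' := fun x => mass a m x * scale_density x0 mu sigma x.
have ccont x : state_space a b x -> {for x, continuous c}.
  by move=> Ix; apply: c_cont; rewrite inE.
have cw : weightable a b m c by exact: (weightable_increasing standing).
have muw : weightable a b m mu by exact: (weightable_mu standing).
have m_gt0 := speed_density_gt0 standing.
have m_int := speed_density_integrable standing.
have X_derive x : state_space a b x -> is_derive x 1 X (X' x).
  exact: (is_derive_extended_xi standing).
have G_derive x : state_space a b x -> is_derive x 1 G (avg a m c x * X' x).
  by move=> Ix; exact: (is_derive_extended_gfun standing cw Ix).
have X'_gt0 x : state_space a b x -> 0 < X' x by exact: (xi'_gt0 standing).
have A_X' x : state_space a b x -> avg a m mu x * X' x = 1 by exact: (avg_mu_xi' standing).
have Q_gt0 q : Q q -> 0 < q by move=> /Q_pos; rewrite /= in_itv/= andbT.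
have wy_in q : Q q -> [/\ state_space a b (w q), state_space a b (y q) & w q < y q].
  move=> Qq; have [wy_pair _] := wy_max q Qq.
  exact: ordered_pairs_interior wy_pair (w_gt_a q Qq).
have ratio_max q : Q q -> forall u v,
    state_space a b u -> state_space a b v -> u < v ->
    reward_ratio X G (with_parameter k th q) u v
      <= reward_ratio X G (with_parameter k th q) (w q) (y q).
  move=> Qq u v Iu Iv uv; have [_ H] := wy_max q Qq.
  by have [] := H u v (interior_ordered_pairs _ _ _ Iu Iv uv).
have ratio_unique q : Q q -> forall u v,
    state_space a b u -> state_space a b v -> u < v ->
    reward_ratio X G (with_parameter k th q) u v
      = reward_ratio X G (with_parameter k th q) (w q) (y q) ->
    u = w q /\ v = y q.
  move=> Qq u v Iu Iv uv; have [_ H] := wy_max q Qq.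
  by have [] := H u v (interior_ordered_pairs _ _ _ Iu Iv uv).
have h_quasiconcave q : Q q -> forall u v z,
    state_space a b u -> state_space a b z -> u < v -> v < z ->
    average_revenue (avg a m mu) (avg a m c) (with_parameter k th q) v
      <= average_revenue (avg a m mu) (avg a m c) (with_parameter k th q) u ->
    average_revenue (avg a m mu) (avg a m c) (with_parameter k th q) z
      < average_revenue (avg a m mu) (avg a m c) (with_parameter k th q) v.
  move=> Qq u v z Iu Iz uv vz.
  have [x1 [x2 [[I1 I2 x12] [inc cst dec]]]] := r_shape q Qq.
  have Iv := state_space_mid Iu Iz (ltW uv) (ltW vz).
  set r := revenue_rate _ _ _ in inc cst dec.
  have rw : weightable a b m r by exact: weightable_lincomb.
  have hE x : state_space a b x ->
      average_revenue (avg a m mu) (avg a m c) (with_parameter k th q) x = avg a m r x.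
    by move=> Ix; rewrite /average_revenue addrC -(avg_lincomb _ _ Ix cw muw).
  have rc : {in state_space a b, continuous r}.
    move=> x; rewrite inE => Ix; apply: cvgD; apply: cvgMl_tmp; first exact: ccont.
    exact: (mu_continuous standing).
  rewrite !hE//.
  apply: (avg_strictly_quasiconcave m_gt0 m_int rw (state_space_gt I1) inc) => //.
  exact: (strict_hump_shape rc I1 I2 x12 inc cst dec).
have A_quasiconcave u v z : state_space a b u -> state_space a b z -> u < v -> v < z ->
    avg a m mu v < avg a m mu u -> avg a m mu z <= avg a m mu v.
  have [x1 [I1 inc conc]] := mu_shape.
  have mu_c : {in state_space a b, continuous mu} by exact: (sa_mu_continuous standing).
  move=> Iu Iz uv vz; apply: (avg_quasiconcave m_gt0 m_int muw) => //.
  exact: (increasing_concave_shape mu_c I1 inc conc).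
have C_ge0 x : state_space a b x -> 0 <= avg a m c x.
  move=> Ix; rewrite divr_ge0//; last exact/ltW/(mass_gt0 m_gt0 m_int).
  apply: intoo_ge0 => u /andP[au ux].
  have Iu : state_space a b u by apply: (state_space_down Ix au); exact: ltW.
  by rewrite mulr_ge0 ?c_ge0// ltW// m_gt0.
have C_ndecr u v : state_space a b u -> state_space a b v -> u <= v ->
    avg a m c u <= avg a m c v.
  move=> Iu Iv uv; apply: (le_avg m_gt0 m_int cw) => // u' v' Iu' Iv'.
  by apply: c_incr; rewrite inE.
have Fd := Fstar_derive X_derive X'_gt0 A_X' G_derive Q_open wy_in ratio_max h_quasiconcave.
have dF := derive1_Fstar_increasing X_derive X'_gt0 A_X' G_derive Q_open wy_in
  ratio_max h_quasiconcave.
have slopeF := @slope_increasing _ _ _ X G th k Q w y wy_in ratio_max.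
have Sp := statics_price X_derive X'_gt0 A_X' G_derive gamma_gt0 Q_gt0 wy_in ratio_max
  ratio_unique h_quasiconcave A_quasiconcave C_ndecr.
have SK := statics_fixed_cost X_derive X'_gt0 A_X' G_derive wy_in ratio_max h_quasiconcave.
have Sg := statics_weight X_derive X'_gt0 A_X' G_derive wy_in ratio_max ratio_unique
  h_quasiconcave C_ge0 C_ndecr.
split; first by move=> q /Fd[].
case kE : k dF slopeF Sp SK Sg => dF slopeF Sp SK Sg; rewrite /Fstar /zstar kE.
- have [incF decy] := Sp erefl.
  (* For the price, the slope of [Fstar] is [zstar] itself, so [slopeF] is the claim about
     [zstar]. *)
  by split; [exact: incF|exact: dF|exact: decy|exact: slopeF].
- have [decF decw incy] := SK erefl.
  by split; [exact: decF|exact: dF|exact: decw|exact: incy].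
- have [incF incw incy] := Sg erefl.
  by split; [exact: incF|exact: dF|exact: incw|exact: incy].
Qed.
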